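(* Let $G$ be a Lie group with Lie algebra $\mathfrak{g}$ and let $(Q,\omega,\varphi)$ be a $G$-symplectic Lie group with action $\varphi: G\times Q\rightarrow Q$, $(g,q)\mapsto \varphi_g(q):=\varphi(g,q)$. Let $\mathfrak{q}$ be the Lie algebra of $Q$. Define $$\varphi': G\rightarrow GL(\mathfrak{q}),\quad g\mapsto \varphi'_g:=(\varphi_g)_{\ast,e}:\mathfrak{q}\rightarrow \mathfrak{q},$$ $$\varphi'': \mathfrak{g}\rightarrow \mathfrak{gl}(\mathfrak{q}),\quad x\mapsto \varphi''_x:=(\varphi')_{\ast,e}(x):\mathfrak{q}\rightarrow \mathfrak{q}.$$ Then: (i) $\varphi'$ is a representation of $G$ on $\mathfrak{q}$ such that $\varphi'_g\in \mathrm{Aut}(\mathfrak{q},\omega_e)$ for all $g\in G$. (ii) $(\mathfrak{q},\omega_e,\varphi'')$ is a $\mathfrak{g}$-quasi-Frobenius Lie algebra.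
   Context: Lie groups are real and finite dimensional; $e$ denotes the identity of any Lie group; the Lie algebra of $Q$ is $\mathfrak{q}=T_eQ$ with the bracket of left-invariant vector fields. A symplectic Lie group is a pair $(Q,\omega)$ with $Q$ a Lie group and $\omega$ a left-invariant symplectic form on $Q$. A homomorphism of symplectic Lie groups is a Lie group homomorphism pulling the target form back to the source form. A $G$-symplectic Lie group is a triple $(Q,\omega,\varphi)$ with $(Q,\omega)$ a symplectic Lie group and $\varphi:G\times Q\to Q$ a smooth left action such that each $\varphi_g:(Q,\omega)\to(Q,\omega)$ is an isomorphism of symplectic Lie groups. A quasi-Frobenius Lie algebra (over $\mathbb{R}$) is a pair $(\mathfrak{q},\beta)$ with $\mathfrak{q}$ a Lie algebra and $\beta$ a nondegenerate skew-symmetric bilinear form on $\mathfrak{q}$ with $\beta([u,v],w)+\beta([v,w],u)+\beta([w,u],v)=0$ for all $u,v,w$. $\mathrm{Aut}(\mathfrak{q},\beta)$ is the group of Lie algebra automorphisms $\psi$ of $\mathfrak{q}$ with $\beta(\psi(u),\psi(v))=\beta(u,v)$ for all $u,v$. A $\mathfrak{g}$-quasi-Frobenius Lie algebra is a triple $(\mathfrak{q},\beta,\rho)$ with $(\mathfrak{q},\beta)$ quasi-Frobenius and $\rho:\mathfrak{g}\to\mathfrak{gl}(\mathfrak{q})$, $x\mapsto\rho_x$, a representation such that each $\rho_x$ is a derivation of $\mathfrak{q}$ and $\beta(\rho_x(u),v)+\beta(u,\rho_x(v))=0$ for all $x\in\mathfrak{g}$, $u,v\in\mathfrak{q}$. 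*)

(* Defs.v *)
From HB Require Import structures.
From mathcomp Require Import all_boot all_order all_algebra.
From mathcomp Require Import all_classical all_reals all_analysis.
From mathcomp Require Import ring.

Set Implicit Arguments.
Unset Strict Implicit.
Unset Printing Implicit Defensive.

Import Order.TTheory GRing.Theory Num.Theory.
Import numFieldNormedType.Exports.

Local Open Scope classical_set_scope.
Local Open Scope ring_scope.

Section smooth_calculus.
Variable R : realType.

(* Ck k U f: f is of class C^k on the open set U. *)
Fixpoint Ck n (k : nat) (U : set 'rV[R]_n) (f : 'rV[R]_n -> R) : Prop :=
  if k is k'.+1 then
    (forall x, U x -> differentiable (f : 'rV[R]_n -> R^o) x) /\
    (forall v : 'rV[R]_n, Ck k' U ('D_v (f : 'rV[R]_n -> R^o)))
  else forall x, U x -> {for x, continuous f}.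

Definition smooth_near n (f : 'rV[R]_n -> R) (x : 'rV[R]_n) : Prop :=
  exists2 U, open_nbhs x U & forall k, Ck k U f.

Lemma near_eq_differentiable n (f g : 'rV[R]_n -> R^o) x :
  (\forall y \near x, f y = g y) -> differentiable f x -> differentiable g x.
Proof.
move=> fg df; have /diff_locallyP[dfc dfo] := df.
have go : g \o shift x = cst (g x) + 'd f x +o_ 0 id.
  apply/eqaddoP => _ /posnumP[e].
  move/eqaddoP : dfo => /(_ e%:num ltac:(done)) dfo.
  have fgx : f x = g x by exact: nbhs_singleton fg.
  have sfg : \forall y \near (0 : 'rV[R]_n), f (y + x) = g (y + x).
    have cx : continuous (fun y : 'rV[R]_n => y + x).
      by move=> y; apply: continuousD; [exact: cvg_id|exact: cst_continuous].
    by have := cx 0; rewrite /continuous_at add0r => /(_ _ fg).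
  apply: filterS2 dfo sfg => y dfo sfg.
  suff -> : (g \o shift x - (cst (g x) + 'd f x)) y =
    (f \o shift x - (cst (f x) + 'd f x)) y by [].
  by rewrite /= !fctE /= /shift /= sfg fgx.
by apply/diff_locallyP; rewrite (diff_unique dfc go).
Qed.

Lemma Ck_ext n k (U : set 'rV[R]_n) f g : open U ->
  (forall x, U x -> f x = g x) -> Ck k U f -> Ck k U g.
Proof.
move=> oU; elim: k f g => [|k IH] f g fg.
  move=> /= cf x Ux.
  have nfg : \forall y \near x, g y = f y.
    by apply: filterS (open_nbhs_nbhs (conj oU Ux)) => y /fg.
  rewrite /prop_for /continuous_at -(fg _ Ux).
  by move=> A /(cf x Ux); apply: filterS2 nfg => y /= ->.
move=> [df Df]; split=> [x Ux|v].
  apply: near_eq_differentiable (df x Ux).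
  by apply: filterS (open_nbhs_nbhs (conj oU Ux)) => y /fg.
apply: IH (Df v) => x Ux; apply: near_eq_derive => //.
by apply: filterS (open_nbhs_nbhs (conj oU Ux)) => y /fg.
Qed.

Lemma Ck_sub n k (U V : set 'rV[R]_n) f : V `<=` U -> Ck k U f -> Ck k V f.
Proof.
move=> VU; elim: k f => [|k IH] f /=; first by move=> cf x /VU /cf.
by move=> [df Df]; split=> [x /VU /df //|v]; exact: IH.
Qed.

Lemma CkW n k (U : set 'rV[R]_n) f : Ck k.+1 U f -> Ck k U f.
Proof.
elim: k f => [|k IH] f; first by move=> [df _] x Ux; exact/differentiable_continuous/df.
by move=> [df Df]; split=> // v; exact/IH/Df.
Qed.

Lemma Ck_cst n k (U : set 'rV[R]_n) (a : R) : Ck k U (fun=> a).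
Proof.
elim: k a => [|k IH] a /=; first by move=> x _; exact: cst_continuous.
split=> [x _|v]; first exact: differentiable_cst.
suff -> : 'D_v (fun=> a : R^o) = (fun=> 0) by exact: IH.
by apply/funext => x; rewrite -/(cst _) derive_cst.
Qed.

Lemma CkD n k (U : set 'rV[R]_n) f g : open U ->
  Ck k U f -> Ck k U g -> Ck k U (fun x => f x + g x).
Proof.
move=> oU; elim: k f g => [|k IH] f g.
  by move=> cf cg x Ux; apply: continuousD; [exact: cf|exact: cg].
move=> [df Df] [dg Dg]; split=> [x Ux|v].
  by apply: differentiableD; [exact: df|exact: dg].
apply: Ck_ext (IH _ _ (Df v) (Dg v)) => // x Ux.
by rewrite -deriveD//; apply: diff_derivable; [exact: df|exact: dg].
Qed.

Lemma CkM n k (U : set 'rV[R]_n) f g : open U ->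
  Ck k U f -> Ck k U g -> Ck k U (fun x => f x * g x).
Proof.
move=> oU; elim: k f g => [|k IH] f g.
  by move=> cf cg x Ux; apply: continuousM; [exact: cf|exact: cg].
move=> Cf Cg; move: (Cf) (Cg) => [df Df] [dg Dg]; split=> [x Ux|v].
  by apply: differentiableM; [exact: df|exact: dg].
have := CkD oU (IH _ _ (CkW Cf) (Dg v)) (IH _ _ (CkW Cg) (Df v)).
apply: Ck_ext => // x Ux.
by rewrite deriveM//; apply: diff_derivable; [exact: df|exact: dg].
Qed.

Lemma Ck_sum n k (U : set 'rV[R]_n) (I : finType) (F : I -> 'rV[R]_n -> R) :
  open U -> (forall i, Ck k U (F i)) -> Ck k U (fun x => \sum_i F i x).
Proof.
move=> oU CF; elim: (index_enum I) => [|i s IH].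
  by under eq_fun do rewrite big_nil; exact: Ck_cst.
by under eq_fun do rewrite big_cons; apply: CkD.
Qed.

Lemma continuous_rV (T : topologicalType) m (g : T -> 'rV[R]_m) x :
  (forall j, {for x, continuous (fun y => g y 0 j)}) -> {for x, continuous g}.
Proof.
move=> cg A [P Pg PA].
have : \forall y \near x, forall j, P 0 j (g y 0 j).
  by apply: filter_forall => j; exact: cg (Pg 0 j).
by apply: filterS => y Py; apply: PA => i j; rewrite (ord1 i).
Qed.

Lemma differentiable_rV n m (g : 'rV[R]_n -> 'rV[R]_m) x :
  (forall j, differentiable (fun y => g y 0 j : R^o) x) -> differentiable g x.
Proof.
move=> dg.
have -> : g = \sum_(j < m) (fun y => g y 0 j *: 'e_j : 'rV[R]_m).
  apply/funext => y; rewrite fct_sumE; exact: row_sum_delta.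
apply: differentiable_sum => j; exact: differentiableZl.
Qed.

Lemma Ck_comp n m k (U : set 'rV[R]_n) (V : set 'rV[R]_m)
    (g : 'rV[R]_n -> 'rV[R]_m) (f : 'rV[R]_m -> R) :
  open U -> (forall x, U x -> V (g x)) -> (forall j, Ck k U (fun x => g x 0 j)) ->
  Ck k V f -> Ck k U (f \o g).
Proof.
move=> oU UV; elim: k f => [|k IH] f Cg Cf.
  move=> x Ux; apply: continuous_comp; last exact/Cf/UV.
  by apply: continuous_rV => j; exact: Cg.
have dg x : U x -> differentiable g x.
  by move=> Ux; apply: differentiable_rV => j; exact: (Cg j).1.
have [df Df] := Cf.
split=> [x Ux|v].
  by apply: differentiable_comp; [exact: dg|exact/df/UV].
have Cg' j : Ck k U (fun x => g x 0 j) by exact/CkW/Cg.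
have := Ck_sum oU (fun j => CkM oU ((Cg j).2 v) (IH _ Cg' (Df 'e_j))).
apply: Ck_ext => // x Ux /=.
rewrite deriveE; last by apply: differentiable_comp; [exact: dg|exact/df/UV].
rewrite diff_comp /=; [|exact: dg|exact/df/UV].
rewrite -(deriveE v (dg _ Ux)).
rewrite [in RHS](row_sum_delta ('D_v g x)) linear_sum; apply: eq_bigr => j _.
rewrite linearZ /= -deriveE; last exact/df/UV.
rewrite derive_mx; last exact/diff_derivable/dg.
by rewrite mxE.
Qed.

Definition smooth_map_near n m (g : 'rV[R]_n -> 'rV[R]_m) (x : 'rV[R]_n) :=
  forall j, smooth_near (fun y => g y 0 j) x.

Lemma smooth_near_continuous n (f : 'rV[R]_n -> R) x :
  smooth_near f x -> {for x, continuous f}.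
Proof. by move=> [U [oU Ux] /(_ 0%N)]; apply. Qed.

Lemma smooth_near_near n (f : 'rV[R]_n -> R) x :
  smooth_near f x -> \forall y \near x, smooth_near f y.
Proof.
move=> [U [oU Ux] Cf]; apply: filterS (open_nbhs_nbhs (conj oU Ux)) => y Uy.
by exists U.
Qed.

Lemma smooth_near_ext n (f g : 'rV[R]_n -> R) x :
  (\forall y \near x, f y = g y) -> smooth_near f x -> smooth_near g x.
Proof.
rewrite -nbhs_nearE nbhsE => -[V [oV Vx] fg] [U [oU Ux] Cf].
have oUV : open (U `&` V) by exact: openI.
exists (U `&` V) => // k; apply: (Ck_ext oUV (f := f)) => [y [_ /fg]//|].
by apply: Ck_sub (Cf k) => y [].
Qed.

Lemma smooth_near_cst n (a : R) (x : 'rV[R]_n) : smooth_near (fun=> a) x.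
Proof. by exists setT => [|k]; [split=> //; exact: openT|exact: Ck_cst]. Qed.

Lemma smooth_nearD n (f g : 'rV[R]_n -> R) x :
  smooth_near f x -> smooth_near g x -> smooth_near (fun y => f y + g y) x.
Proof.
move=> [U [oU Ux] Cf] [V [oV Vx] Cg].
have oUV : open (U `&` V) by exact: openI.
exists (U `&` V) => // k; apply: CkD => //.
  by apply: Ck_sub (Cf k) => y [].
by apply: Ck_sub (Cg k) => y [].
Qed.

Lemma smooth_nearM n (f g : 'rV[R]_n -> R) x :
  smooth_near f x -> smooth_near g x -> smooth_near (fun y => f y * g y) x.
Proof.
move=> [U [oU Ux] Cf] [V [oV Vx] Cg].
have oUV : open (U `&` V) by exact: openI.
exists (U `&` V) => // k; apply: CkM => //.
  by apply: Ck_sub (Cf k) => y [].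
by apply: Ck_sub (Cg k) => y [].
Qed.

Lemma smooth_near_comp n m (g : 'rV[R]_n -> 'rV[R]_m) (f : 'rV[R]_m -> R) x :
  smooth_map_near g x -> smooth_near f (g x) -> smooth_near (f \o g) x.
Proof.
move=> sg [V oV Cf].
have /choice[U UP] j : exists U,
    open_nbhs x U /\ forall k, Ck k U (fun y => g y 0 j).
  by have [U] := sg j; exists U.
pose S := [set y | (forall j, U j y) /\ V (g y)].
have cg : {for x, continuous g}.
  by apply: continuous_rV => j; exact/smooth_near_continuous/sg.
have Sx : nbhs x S.
  have gV : \forall y \near x, V (g y) by exact: cg (open_nbhs_nbhs oV).
  have US : \forall y \near x, forall j, U j y.
    have FF : Filter (nbhs x) by exact: nbhs_filter.
    by apply: (filter_forall FF) => j; exact: open_nbhs_nbhs (UP j).1.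
  by apply: filterS2 US gV.
exists S° => [|k]; first by split; [exact: open_interior|].
apply: (@Ck_comp _ _ _ _ V) (Cf k) => [|y Sy|j]; first exact: open_interior.
  by have [] := interior_subset Sy.
by apply: Ck_sub ((UP j).2 k) => y /interior_subset[].
Qed.

End smooth_calculus.

(* cmap and cinv are total functions; only their values on cdom and ccod
   matter. *)
Record chart (R : realType) (n : nat) (M : topologicalType) := Chart {
  cdom : set M ;
  ccod : set 'rV[R]_n ;
  cmap :> M -> 'rV[R]_n ;
  cinv : 'rV[R]_n -> M ;
  cdom_open : open cdom ;
  ccod_open : open ccod ;
  cmap_cod : forall p, cdom p -> ccod (cmap p) ;
  cinv_dom : forall x, ccod x -> cdom (cinv x) ;
  cmapK : forall p, cdom p -> cinv (cmap p) = p ;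
  cinvK : forall x, ccod x -> cmap (cinv x) = x ;
  cmap_continuous : forall p, cdom p -> {for p, continuous cmap} ;
  cinv_continuous : forall x, ccod x -> {for x, continuous cinv} }.

HB.mixin Record isManifold (R : realType) (n : nat) M & Topological M := {
  atlas : set (chart R n M) ;
  atlas_cover : forall p : M, exists2 c, atlas c & cdom c p ;
  atlas_compat : forall c d, atlas c -> atlas d ->
    forall p, cdom c p -> cdom d p -> smooth_map_near (d \o cinv c) (c p) ;
  manifold_hausdorff : hausdorff_space M ;
  manifold_second_countable : @second_countable M }.

#[short(type="manifoldType")]
HB.structure Definition Manifold (R : realType) (n : nat) :=
  {M of isManifold R n M & Topological M}.

Arguments atlas_compat {R n s} [c d] _ _ [p].

Section smooth_maps.
Variables (R : realType).

Definition smooth_fun_at n (M : manifoldType R n) (p : M) (f : M -> R) : Prop :=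
  exists c : chart R n M,
    [/\ atlas c, cdom c p & smooth_near (f \o cinv c) (c p)].

(* Continuity of F at p makes d \o F \o cinv c the genuine local expression of F
   on a neighbourhood of c p, although d is total. *)
Definition smooth_at n m (M : manifoldType R n) (N : manifoldType R m)
    (F : M -> N) (p : M) : Prop :=
  {for p, continuous F} /\
  exists (c : chart R n M) (d : chart R m N),
    [/\ atlas c, cdom c p, atlas d, cdom d (F p) &
        smooth_map_near (d \o F \o cinv c) (c p)].

Definition smooth n m (M : manifoldType R n) (N : manifoldType R m)
  (F : M -> N) : Prop := forall p, smooth_at F p.

Section charts.
Variables (n : nat) (M : topologicalType) (c : chart R n M).

Lemma cinv_near p (A : set M) : cdom c p -> nbhs p A ->
  \forall x \near c p, A (cinv c x).
Proof.
move=> cp pA; have := cinv_continuous (cmap_cod cp); rewrite /prop_for.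
by rewrite /continuous_at (cmapK cp) => /(_ _ pA).
Qed.

Lemma cmap_near p (B : set 'rV[R]_n) : cdom c p -> nbhs (c p) B ->
  \forall q \near p, B (c q).
Proof. by move=> cp pB; have := cmap_continuous cp pB. Qed.

Lemma cdom_near p : cdom c p -> \forall q \near p, cdom c q.
Proof. by move=> cp; apply: open_nbhs_nbhs; split=> //; exact: cdom_open. Qed.

Lemma ccod_near p : cdom c p -> \forall x \near c p, ccod c x.
Proof.
by move=> cp; apply: open_nbhs_nbhs; split; [exact: ccod_open|exact: cmap_cod].
Qed.

End charts.

Section smooth_fun.
Variables (n : nat) (M : manifoldType R n).
Implicit Types (p : M) (f g : M -> R) (c : chart R n M).

Lemma smooth_fun_atE p f c : atlas c -> cdom c p ->
  smooth_fun_at p f <-> smooth_near (f \o cinv c) (c p).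
Proof.
move=> Ac cp; split=> [[d [Ad dp sf]]|]; last by exists c.
have := smooth_near_comp (x := c p) (atlas_compat Ac Ad cp dp).
rewrite /= (cmapK cp) => /(_ _ sf); apply: smooth_near_ext.
apply: filterS (cinv_near cp (cdom_near dp)) => x dx /=.
by rewrite (cmapK dx).
Qed.

Lemma smooth_fun_at_ext p f g :
  (\forall q \near p, f q = g q) -> smooth_fun_at p f -> smooth_fun_at p g.
Proof.
move=> fg [c [Ac cp sf]]; exists c; split=> //.
by apply: smooth_near_ext sf; exact: cinv_near cp fg.
Qed.

Lemma smooth_fun_at_cst p (a : R) : smooth_fun_at p (fun=> a).
Proof.
by have [c Ac cp] := atlas_cover p; exists c; split=> //; exact: smooth_near_cst.
Qed.

Lemma smooth_fun_atD p f g : smooth_fun_at p f -> smooth_fun_at p g ->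
  smooth_fun_at p (fun q => f q + g q).
Proof.
move=> [c [Ac cp sf]] /(smooth_fun_atE _ Ac cp) sg; exists c; split=> //.
exact: smooth_nearD.
Qed.

Lemma smooth_fun_atM p f g : smooth_fun_at p f -> smooth_fun_at p g ->
  smooth_fun_at p (fun q => f q * g q).
Proof.
move=> [c [Ac cp sf]] /(smooth_fun_atE _ Ac cp) sg; exists c; split=> //.
exact: smooth_nearM.
Qed.

Lemma smooth_fun_at_near p f :
  smooth_fun_at p f -> \forall q \near p, smooth_fun_at q f.
Proof.
move=> [c [Ac cp /smooth_near_near sf]].
apply: filterS2 (cdom_near cp) (cmap_near cp sf) => q cq sq.
by exists c.
Qed.

End smooth_fun.

Lemma smooth_fun_at_comp n m (M : manifoldType R n) (N : manifoldType R m)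
    (F : M -> N) p (f : N -> R) :
  smooth_at F p -> smooth_fun_at (F p) f -> smooth_fun_at p (f \o F).
Proof.
move=> [cF [c [d [Ac cp Ad dp sF]]]] /(smooth_fun_atE _ Ad dp) sf.
exists c; split=> //.
have := smooth_near_comp sF; rewrite /= (cmapK cp) => /(_ _ sf).
apply: smooth_near_ext.
have : \forall q \near p, cdom d (F q) by exact: cF (cdom_near dp).
move=> /(cinv_near cp); apply: filterS => x dx /=.
by rewrite (cmapK dx).
Qed.

End smooth_maps.

Lemma hausdorff_prod (T U : topologicalType) :
  hausdorff_space T -> hausdorff_space U -> hausdorff_space (T * U)%type.
Proof.
move=> hT hU [p1 p2] [q1 q2] pq; congr pair.
- apply: hT => A B Ap Bq.
  have [] := pq (fst @^-1` A) (fst @^-1` B).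
  + by exists (A, setT) => [|[a b] []//]; split=> //; exact: filterT.
  + by exists (B, setT) => [|[a b] []//]; split=> //; exact: filterT.
  by move=> [a b] [Aa Ba]; exists a.
- apply: hU => A B Ap Bq.
  have [] := pq (snd @^-1` A) (snd @^-1` B).
  + by exists (setT, A) => [|[a b] []//]; split=> //; exact: filterT.
  + by exists (setT, B) => [|[a b] []//]; split=> //; exact: filterT.
  by move=> [a b] [Aa Ba]; exists b.
Qed.

Lemma openX (T U : topologicalType) (A : set T) (B : set U) :
  open A -> open B -> open (A `*` B).
Proof.
rewrite !openE => oA oB [a b] /= [/oA Aa /oB Bb].
by exists (A, B).
Qed.

Lemma second_countable_prod (T U : topologicalType) :
  @second_countable T -> @second_countable U -> @second_countable (T * U)%type.
Proof.
move=> [A cA [oA bA]] [B cB [oB bB]].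
exists [set X.1 `*` X.2 | X in A `*` B].
  apply: sub_countable (card_image_le _ _) _; exact: countableX.
split=> [_ [[X Y] [/= /oA oX /oB oY] <-]|[p q] S [[X Y] [/= Xp Yq] XYS]].
  exact: openX.
have [X' [AX' X'p] X'X] := bA p X Xp.
have [Y' [BY' Y'q] Y'Y] := bB q Y Yq.
exists (X' `*` Y'); first by split=> //; exists (X', Y').
by move=> [a b] [/X'X Xa /Y'Y Yb]; exact: XYS.
Qed.

Section product_manifold.
Variables (R : realType) (n m : nat).

Lemma Ck_coord l k (U : set 'rV[R]_l) (j : 'I_l) : Ck k U (fun x => x 0 j).
Proof.
case: k => [|k] /=; first by move=> x _; exact: coord_continuous.
split=> [x _|v]; first exact: differentiable_coord.
suff -> : 'D_v (fun x : 'rV[R]_l => x 0 j : R^o) = (fun=> v 0 j) by exact: Ck_cst.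
apply/funext => x.
have /derive_mx : derivable (@id (matrix R 1 l)) x v by exact: derivable_id.
by rewrite derive_id => /matrixP/(_ 0 j); rewrite mxE => ->.
Qed.

Lemma smooth_near_coord l (x : 'rV[R]_l) (j : 'I_l) :
  smooth_near (fun y => y 0 j) x.
Proof. by exists setT => [|k]; [split=> //; exact: openT|exact: Ck_coord]. Qed.

Section product_chart.
Variables (M N : topologicalType) (c : chart R n M) (d : chart R m N).

Let pdom := cdom c `*` cdom d.
Let pcod := [set x : 'rV[R]_(n + m) | ccod c (lsubmx x) /\ ccod d (rsubmx x)].
Let pmap (p : M * N) : 'rV[R]_(n + m) := row_mx (c p.1) (d p.2).
Let pinv (x : 'rV[R]_(n + m)) := (cinv c (lsubmx x), cinv d (rsubmx x)).

Let pdom_open : open pdom.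
Proof. by apply: openX; exact: cdom_open. Qed.

Let pcod_open : open pcod.
Proof.
apply: openI.
  by apply: open_comp (@ccod_open _ _ _ c) => x _; exact: continuous_lsubmx.
by apply: open_comp (@ccod_open _ _ _ d) => x _; exact: continuous_rsubmx.
Qed.

Let pmap_cod p : pdom p -> pcod (pmap p).
Proof.
by move=> [cp dp]; split; rewrite ?row_mxKl ?row_mxKr; exact: cmap_cod.
Qed.

Let pinv_dom x : pcod x -> pdom (pinv x).
Proof. by move=> [cx dx]; split; exact: cinv_dom. Qed.

Let pmapK p : pdom p -> pinv (pmap p) = p.
Proof.
by case: p => p q [cp dp]; rewrite /pinv row_mxKl row_mxKr !cmapK.
Qed.

Let pinvK x : pcod x -> pmap (pinv x) = x.
Proof. by move=> [cx dx]; rewrite /pmap /= !cinvK// hsubmxK. Qed.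

Let pmap_continuous p : pdom p -> {for p, continuous pmap}.
Proof.
move=> [cp dp]; apply: continuous_rV => j.
case: (split_ordP j) => i ->.
  rewrite (_ : (fun _ => _) = (fun x : 'rV[R]_n => x 0 i) \o (c \o fst)); last first.
    by apply/funext => q /=; rewrite row_mxEl.
  apply: continuous_comp; last exact: coord_continuous.
  by apply: continuous_comp; [exact: cvg_fst|exact: cmap_continuous].
rewrite (_ : (fun _ => _) = (fun x : 'rV[R]_m => x 0 i) \o (d \o snd)); last first.
  by apply/funext => q /=; rewrite row_mxEr.
apply: continuous_comp; last exact: coord_continuous.
by apply: continuous_comp; [exact: cvg_snd|exact: cmap_continuous].
Qed.

Let pinv_continuous x : pcod x -> {for x, continuous pinv}.
Proof.
move=> [cx dx].
have c1 : {for x, continuous (cinv c \o lsubmx)}.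
  by apply: continuous_comp; [exact: continuous_lsubmx|exact: cinv_continuous].
have c2 : {for x, continuous (cinv d \o rsubmx)}.
  by apply: continuous_comp; [exact: continuous_rsubmx|exact: cinv_continuous].
move=> A [[P Q] [/= /c1 xP /c2 xQ] PQA].
have FF : Filter (nbhs x) by exact: nbhs_filter.
by apply: (@filterS2 _ _ FF _ _ _ _ xP xQ) => y Py Qy; exact: PQA.
Qed.

Definition prod_chart : chart R (n + m) (M * N)%type :=
  Chart pdom_open pcod_open pmap_cod pinv_dom pmapK pinvK
    pmap_continuous pinv_continuous.

End product_chart.

Variables (M : manifoldType R n) (N : manifoldType R m).

Definition prod_atlas : set (chart R (n + m) (M * N)%type) :=
  [set prod_chart cd.1 cd.2 | cd in (@atlas R n M `*` @atlas R m N)].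

Let prod_atlas_cover (p : M * N) : exists2 c, prod_atlas c & cdom c p.
Proof.
have [c Ac cp] := atlas_cover p.1; have [d Ad dp] := atlas_cover p.2.
by exists (prod_chart c d) => //; exists (c, d).
Qed.

Let prod_atlas_compat c d : prod_atlas c -> prod_atlas d ->
  forall p, cdom c p -> cdom d p -> smooth_map_near (d \o cinv c) (c p).
Proof.
move=> [[c1 c2] [/= Ac1 Ac2] <-] [[d1 d2] [/= Ad1 Ad2] <-] p [cp1 cp2] [dp1 dp2] j.
case: (split_ordP j) => i ->.
  rewrite (_ : (fun _ => _) =
      (fun x => (d1 \o cinv c1) x 0 i) \o (@lsubmx R 1 n m)); last first.
    by apply/funext => x /=; rewrite row_mxEl.
  apply: smooth_near_comp; last first.
    by rewrite row_mxKl; exact: (atlas_compat Ac1 Ad1).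
  by move=> l; under eq_fun do rewrite mxE; exact: smooth_near_coord.
rewrite (_ : (fun _ => _) =
    (fun x => (d2 \o cinv c2) x 0 i) \o (@rsubmx R 1 n m)); last first.
  by apply/funext => x /=; rewrite row_mxEr.
apply: smooth_near_comp; last first.
  by rewrite row_mxKr; exact: (atlas_compat Ac2 Ad2).
by move=> l; under eq_fun do rewrite mxE; exact: smooth_near_coord.
Qed.

HB.instance Definition _ := isManifold.Build R (n + m)%N (M * N)%type
  prod_atlas_cover prod_atlas_compat
  (hausdorff_prod (@manifold_hausdorff R n M) (@manifold_hausdorff R m N))
  (second_countable_prod (@manifold_second_countable R n M)
    (@manifold_second_countable R m N)).

End product_manifold.

HB.mixin Record isLieGroup (R : realType) (n : nat) G
    & Manifold R n G & Group G := {
  mulg_smooth : smooth (fun p : G * G => (p.1 * p.2)%g) ;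
  invg_smooth : smooth (fun g : G => g^-1%g) }.

#[short(type="lieGroupType")]
HB.structure Definition LieGroup (R : realType) (n : nat) :=
  {G of isLieGroup R n G & Manifold R n G & Group G}.

(* Tangent vectors are derivations of germs of smooth functions.  A germ at p
   is represented by any function M -> R that is smooth near p; the value 0
   imposed on the other functions only makes the representation unique. *)
Section tangent_space.
Variables (R : realType) (n : nat) (M : manifoldType R n) (p : M).

Record point_derivation (D : (M -> R) -> R) : Prop := PointDerivation {
  derivation0 : forall f, ~ smooth_fun_at p f -> D f = 0 ;
  derivation_germ : forall f g, smooth_fun_at p f ->
    (\forall q \near p, f q = g q) -> D f = D g ;
  derivation_linear : forall (a : R) f g,
    smooth_fun_at p f -> smooth_fun_at p g ->
    D (fun q => a * f q + g q) = a * D f + D g ;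
  derivation_leibniz : forall f g, smooth_fun_at p f -> smooth_fun_at p g ->
    D (fun q => f q * g q) = f p * D g + g p * D f }.

Definition point_derivationb : {pred (M -> R) -> R^o} :=
  fun D => `[< point_derivation D >].

Record tangent := Tangent {
  tangent_fun :> (M -> R) -> R^o ;
  tangent_subproof : point_derivationb tangent_fun }.

HB.instance Definition _ := [isSub for tangent_fun].
HB.instance Definition _ := [Choice of tangent by <:].

Lemma tangentP (v : tangent) : point_derivation v.
Proof. exact/asboolP/tangent_subproof. Qed.

Lemma point_derivation_submod_closed : submod_closed point_derivationb.
Proof.
split=> [|a D E /asboolP[D0 Dg Dl DL] /asboolP[E0 Eg El EL]]; apply/asboolP.
  have z f : (0 : (M -> R) -> R^o) f = 0 by [].
  by split=> *; rewrite !z ?mulr0 ?addr0.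
split=> [f sf|f g sf fg|b f g sf sg|f g sf sg]; rewrite !fctE /=.
- by rewrite D0// E0// scaler0 addr0.
- by rewrite (Dg _ _ sf fg) (Eg _ _ sf fg).
- by rewrite Dl// El// /GRing.scale /=; ring.
- by rewrite DL// EL// /GRing.scale /=; ring.
Qed.

HB.instance Definition _ := GRing.isSubmodClosed.Build R ((M -> R) -> R^o)
  point_derivationb point_derivation_submod_closed.
HB.instance Definition _ := [SubChoice_isSubLmodule of tangent by <:].

End tangent_space.
(* The differential F_{*,p} : T_p M -> T_q N, where q is meant to be F p: a
   separate argument q saves casts along equations such as F e = e.  When F is
   smooth at p and q = F p, it is v |-> (f |-> v (f \o F)) (tangent_mapE); the
   other branch is never used. *)
Section tangent_map.
Variables (R : realType) (n m : nat).
Variables (M : manifoldType R n) (N : manifoldType R m).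
Variables (F : M -> N) (p : M) (q : N).

Definition push (v : tangent p) (f : N -> R) : R^o :=
  if `[< smooth_fun_at q f >] then v (f \o F) else 0.

Lemma push_derivation (v : tangent p) :
  smooth_at F p /\ F p = q -> point_derivationb q (push v).
Proof.
move=> [sF Fpq]; have [v0 vg vl vL] := tangentP v.
have sc f : smooth_fun_at q f -> smooth_fun_at p (f \o F).
  by rewrite -Fpq; exact: smooth_fun_at_comp.
apply/asboolP; rewrite /push; split=> [f nsf|f g sf fg|a f g sf sg|f g sf sg].
- by rewrite asboolF.
- rewrite !asboolT//; last exact: smooth_fun_at_ext sf.
  apply: vg; first exact: sc.
  by have := sF.1; rewrite /prop_for /continuous_at Fpq => /(_ _ fg).
- rewrite !asboolT//; first by rewrite -vl//; exact: sc.
  apply: smooth_fun_atD sg; apply: smooth_fun_atM sf; exact: smooth_fun_at_cst.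
- rewrite !asboolT//; first by rewrite -Fpq; apply: vL; exact: sc.
  exact: smooth_fun_atM.
Qed.

Definition tangent_map (v : tangent p) : tangent q :=
  if pselect (smooth_at F p /\ F p = q) is left h
  then Tangent (push_derivation v h) else 0.

Lemma tangent_mapE (v : tangent p) f : smooth_at F p -> F p = q ->
  smooth_fun_at q f -> tangent_map v f = v (f \o F).
Proof.
move=> sF Fpq sf; rewrite /tangent_map; case: pselect => [h|[]//] /=.
by rewrite /push asboolT.
Qed.

Lemma tangent_map_linear : linear tangent_map.
Proof.
move=> a u v; rewrite /tangent_map; case: pselect => [h|_]; last first.
  by rewrite scaler0 addr0.
apply/val_inj/funext => f /=.
rewrite !fctE /= /push; case: asboolP => // _.
by rewrite scaler0 addr0.
Qed.

End tangent_map.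

Section vector_fields.
Variables (R : realType) (n : nat) (M : manifoldType R n).

Definition vfield := forall p : M, tangent p.

Definition smooth_vfield (X : vfield) : Prop :=
  forall p f, smooth_fun_at p f -> smooth_fun_at p (fun q => X q f).

Variables (X Y : vfield).

Definition vcommutator (p : M) (f : M -> R) : R^o :=
  if `[< smooth_fun_at p f >]
  then X p (fun q => Y q f) - Y p (fun q => X q f) else 0.

Lemma vcommutator_derivation (p : M) :
  smooth_vfield X /\ smooth_vfield Y -> point_derivationb p (vcommutator p).
Proof.
move=> [sX sY].
have nearE (Z : vfield) f g : (\forall q \near p, f q = g q) ->
    smooth_fun_at p f -> \forall q \near p, Z q f = Z q g.
  rewrite -nbhs_nearE => /nbhs_interior fg /smooth_fun_at_near sf.
  apply: filterS2 fg sf => q fgq sfq.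
  exact: (derivation_germ (tangentP (Z q))).
have nearl (Z : vfield) a f g : smooth_fun_at p f -> smooth_fun_at p g ->
    \forall q \near p, Z q (fun r => a * f r + g r) = a * Z q f + Z q g.
  move=> /smooth_fun_at_near sf /smooth_fun_at_near sg.
  by apply: filterS2 sf sg => q; exact: (derivation_linear (tangentP (Z q))).
have nearL (Z : vfield) f g : smooth_fun_at p f -> smooth_fun_at p g ->
    \forall q \near p, Z q (fun r => f r * g r) = f q * Z q g + g q * Z q f.
  move=> /smooth_fun_at_near sf /smooth_fun_at_near sg.
  by apply: filterS2 sf sg => q; exact: (derivation_leibniz (tangentP (Z q))).
have sl a f g : smooth_fun_at p f -> smooth_fun_at p g ->
    smooth_fun_at p (fun q => a * f q + g q).
  move=> sf; apply: smooth_fun_atD; apply: smooth_fun_atM sf.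
  exact: smooth_fun_at_cst.
have [_ Xg Xl XL] := tangentP (X p); have [_ Yg Yl YL] := tangentP (Y p).
have XD f g : smooth_fun_at p f -> smooth_fun_at p g ->
    X p (fun q => f q + g q) = X p f + X p g.
  move=> sf sg; rewrite -[X p f]mul1r -Xl//.
  by congr (X p _); apply/funext => q; rewrite mul1r.
have YD f g : smooth_fun_at p f -> smooth_fun_at p g ->
    Y p (fun q => f q + g q) = Y p f + Y p g.
  move=> sf sg; rewrite -[Y p f]mul1r -Yl//.
  by congr (Y p _); apply/funext => q; rewrite mul1r.
apply/asboolP; rewrite /vcommutator.
split=> [f nsf|f g sf fg|a f g sf sg|f g sf sg].
- by rewrite asboolF.
- rewrite !asboolT//; last exact: smooth_fun_at_ext sf.
  rewrite (Xg _ _ (sY _ _ sf) (nearE Y _ _ fg sf)).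
  by rewrite (Yg _ _ (sX _ _ sf) (nearE X _ _ fg sf)).
- rewrite !asboolT//; last exact: sl.
  rewrite (Xg _ _ (sY _ _ (sl a _ _ sf sg)) (nearl Y a _ _ sf sg)).
  rewrite (Yg _ _ (sX _ _ (sl a _ _ sf sg)) (nearl X a _ _ sf sg)).
  by rewrite Xl ?Yl; [ring|exact: sX|exact: sX|exact: sY|exact: sY].
- have sfg := smooth_fun_atM sf sg.
  rewrite !asboolT//.
  rewrite (Xg _ _ (sY _ _ sfg) (nearL Y _ _ sf sg)).
  rewrite (Yg _ _ (sX _ _ sfg) (nearL X _ _ sf sg)).
  have [Xf Xg' Yf Yg'] := And4 (sX _ _ sf) (sX _ _ sg) (sY _ _ sf) (sY _ _ sg).
  rewrite XD ?YD; try exact: smooth_fun_atM.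
  by rewrite !XL// !YL//; ring.
Qed.

(* On smooth vector fields this is [X, Y] = XY - YX (vbracketE); the other branch
   only makes the operation total. *)
Definition vbracket : vfield := fun p =>
  if pselect (smooth_vfield X /\ smooth_vfield Y) is left h
  then Tangent (vcommutator_derivation p h) else 0.

Lemma vbracketE p f : smooth_vfield X -> smooth_vfield Y ->
  smooth_fun_at p f ->
  vbracket p f = X p (fun q => Y q f) - Y p (fun q => X q f).
Proof.
move=> sX sY sf; rewrite /vbracket; case: pselect => [h|[]//] /=.
by rewrite /vcommutator asboolT.
Qed.

End vector_fields.

Section linear_endomorphisms.
Variables (R : realType) (V : lmodType R).

Definition linearb : {pred V -> V} := fun f => `[< linear f >].

Record gl := Gl { gl_fun :> V -> V ; gl_subproof : linearb gl_fun }.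

HB.instance Definition _ := [isSub for gl_fun].
HB.instance Definition _ := [Choice of gl by <:].

Lemma linearb_submod_closed : submod_closed linearb.
Proof.
split=> [|a f g /asboolP lf /asboolP lg]; apply/asboolP => b u v.
  by rewrite -[RHS]/(b *: 0 + 0) scaler0 addr0.
rewrite !fctE /= lf lg !scalerDr !scalerA (mulrC a b) -!addrA; congr (_ + _).
by rewrite addrCA.
Qed.

HB.instance Definition _ := GRing.isSubmodClosed.Build R (V -> V)
  linearb linearb_submod_closed.
HB.instance Definition _ := [SubChoice_isSubLmodule of gl by <:].

End linear_endomorphisms.

(* Maps into a finite-dimensional real vector space V, with its standard
   smooth structure: F is smooth when its composites with the linear functionals
   are, and under the canonical identification T_w V = V its differential sends
   x in T_p M to the unique w in V with l w = x (l \o F) for all l in V^*. *)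
Section vector_valued.
Variables (R : realType) (n : nat) (M : manifoldType R n) (V : lmodType R).

Definition smooth_vec (F : M -> V) : Prop :=
  forall (l : {scalar V}) p, smooth_fun_at p (l \o F).

Definition vec_differential (F : M -> V) (p : M) (x : tangent p) : V :=
  xget 0 [set w | forall l : {scalar V}, l w = x (l \o F)].

End vector_valued.

Section lie_algebras.
Variable R : realType.

Record is_lie_algebra (V : lmodType R) (br : V -> V -> V) : Prop := {
  lie_linearl : forall v, linear (br^~ v) ;
  lie_linearr : forall u, linear (br u) ;
  lie_alternating : forall u, br u u = 0 ;
  lie_jacobi : forall u v w,
    br u (br v w) + br v (br w u) + br w (br u v) = 0 }.

Record is_skew_form (V : lmodType R) (beta : V -> V -> R) : Prop := {
  form_linearl : forall v, scalar (beta^~ v) ;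
  form_linearr : forall u, scalar (beta u) ;
  form_skew : forall u v, beta u v = - beta v u }.

Definition nondegenerate (V : lmodType R) (beta : V -> V -> R) : Prop :=
  forall u, (forall v, beta u v = 0) -> u = 0.

Record is_quasi_frobenius (V : lmodType R) (br : V -> V -> V)
    (beta : V -> V -> R) : Prop := {
  qf_lie : is_lie_algebra br ;
  qf_form : is_skew_form beta ;
  qf_nondegenerate : nondegenerate beta ;
  qf_cocycle : forall u v w,
    beta (br u v) w + beta (br v w) u + beta (br w u) v = 0 }.

Record is_qf_automorphism (V : lmodType R) (br : V -> V -> V)
    (beta : V -> V -> R) (psi : V -> V) : Prop := {
  qfaut_linear : linear psi ;
  qfaut_bijective : bijective psi ;
  qfaut_bracket : forall u v, psi (br u v) = br (psi u) (psi v) ;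
  qfaut_form : forall u v, beta (psi u) (psi v) = beta u v }.

Record is_lie_representation (g V : lmodType R) (brg : g -> g -> g)
    (rho : g -> gl V) : Prop := {
  lrep_lie : is_lie_algebra brg ;
  lrep_linear : linear rho ;
  lrep_bracket : forall x y u,
    rho (brg x y) u = rho x (rho y u) - rho y (rho x u) }.

Record is_g_quasi_frobenius (g V : lmodType R) (brg : g -> g -> g)
    (br : V -> V -> V) (beta : V -> V -> R) (rho : g -> gl V) : Prop := {
  gqf_quasi_frobenius : is_quasi_frobenius br beta ;
  gqf_representation : is_lie_representation brg rho ;
  gqf_derivation : forall x u v,
    rho x (br u v) = br (rho x u) v + br u (rho x v) ;
  gqf_invariant : forall x u v, beta (rho x u) v + beta u (rho x v) = 0 }.

End lie_algebras.

Section lie_groups.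
Variables (R : realType) (n : nat) (G : lieGroupType R n).

Definition left_translation (g : G) : G -> G := fun h => (g * h)%g.

Definition left_invariant_vfield (u : tangent (1%g : G)) : vfield G :=
  fun g => tangent_map (left_translation g) g u.

(* [u, v] is the value at e of the bracket of the left-invariant vector fields
   extending u and v, which are smooth. *)
Definition lie_bracket (u v : tangent (1%g : G)) : tangent (1%g : G) :=
  vbracket (left_invariant_vfield u) (left_invariant_vfield v) 1%g.

Record is_group_representation (V : lmodType R) (F : G -> gl V) : Prop := {
  rep_one : forall u, F 1%g u = u ;
  rep_mul : forall g h u, F (g * h)%g u = F g (F h u) ;
  rep_bijective : forall g, bijective (F g) ;
  rep_smooth : smooth_vec F }.

End lie_groups.

Section forms.
Variables (R : realType) (n : nat).

Definition form2 (M : manifoldType R n) :=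
  forall p : M, tangent p -> tangent p -> R.

Definition smooth_form2 (M : manifoldType R n) (omega : form2 M) : Prop :=
  forall X Y : vfield M, smooth_vfield X -> smooth_vfield Y ->
  forall p, smooth_fun_at p (fun q => omega q (X q) (Y q)).

(* The invariant formula for d omega (X, Y, Z). *)
Definition exterior_derivative (M : manifoldType R n) (omega : form2 M)
    (X Y Z : vfield M) (p : M) : R :=
  X p (fun q => omega q (Y q) (Z q)) - Y p (fun q => omega q (X q) (Z q))
  + Z p (fun q => omega q (X q) (Y q))
  - omega p (vbracket X Y p) (Z p) + omega p (vbracket X Z p) (Y p)
  - omega p (vbracket Y Z p) (X p).

Record is_symplectic_form (M : manifoldType R n) (omega : form2 M) : Prop := {
  symp_form : forall p, is_skew_form (omega p) ;
  symp_smooth : smooth_form2 omega ;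
  symp_nondegenerate : forall p, nondegenerate (omega p) ;
  symp_closed : forall X Y Z, smooth_vfield X -> smooth_vfield Y ->
    smooth_vfield Z -> forall p, exterior_derivative omega X Y Z p = 0 }.

End forms.

Definition pullback (R : realType) (n m : nat) (M : manifoldType R n)
    (N : manifoldType R m) (F : M -> N) (omega : form2 N) : form2 M :=
  fun p u v => omega (F p) (tangent_map F (F p) u) (tangent_map F (F p) v).

Record is_symplectic_lie_group (R : realType) (n : nat) (Q : lieGroupType R n)
    (omega : form2 Q) : Prop := {
  slg_symplectic : is_symplectic_form omega ;
  slg_left_invariant : forall g : Q, pullback (left_translation g) omega = omega }.

Record is_slg_homomorphism (R : realType) (n m : nat) (P : lieGroupType R n)
    (Q : lieGroupType R m) (eta : form2 P) (omega : form2 Q) (F : P -> Q) :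
    Prop := {
  slghom_smooth : smooth F ;
  slghom_mul : {morph F : x y / (x * y)%g} ;
  slghom_pullback : pullback F omega = eta }.

Definition is_slg_isomorphism (R : realType) (n m : nat) (P : lieGroupType R n)
    (Q : lieGroupType R m) (eta : form2 P) (omega : form2 Q) (F : P -> Q) :
    Prop :=
  is_slg_homomorphism eta omega F /\
  exists2 F', is_slg_homomorphism omega eta F' & cancel F F' /\ cancel F' F.

Record is_G_symplectic_lie_group (R : realType) (n m : nat)
    (G : lieGroupType R n) (Q : lieGroupType R m) (omega : form2 Q)
    (phi : G * Q -> Q) : Prop := {
  gslg_symplectic : is_symplectic_lie_group omega ;
  gslg_smooth : smooth phi ;
  gslg_one : forall q, phi (1%g, q) = q ;
  gslg_mul : forall g h q, phi ((g * h)%g, q) = phi (g, phi (h, q)) ;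
  gslg_iso : forall g, is_slg_isomorphism omega omega (fun q => phi (g, q)) }.

Section induced_representations.
Variables (R : realType) (n m : nat).
Variables (G : lieGroupType R n) (Q : lieGroupType R m) (phi : G * Q -> Q).

Definition phi' (g : G) : gl (tangent (1%g : Q)) :=
  Gl (asboolT (@tangent_map_linear R m m Q Q (fun q => phi (g, q)) 1%g 1%g)).

Definition phi'' (x : tangent (1%g : G)) : gl (tangent (1%g : Q)) :=
  vec_differential phi' x.

End induced_representations.

(* Main.v *)
(* Hadamard's lemma, with remainders given by integrals along rays, makes every
   tangent vector a combination of the coordinate derivations.  Hence a partial
   tangent derivative p |-> u (F (p, .)) of a smooth F is smooth, which makes
   left-invariant fields and phi' smooth; and q is finite dimensional, so that
   phi''_x u f = x (g |-> u (f \o phi_g)) and x obeys the Leibniz rule on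
   bilinear expressions in phi'_g.  Applying x to the invariance of the bracket
   and of omega_e under phi'_g gives the infinitesimal statements; phi''
   preserves brackets because phi' is multiplicative, and the cocycle identity
   is d omega = 0 on left-invariant fields, on which omega is constant. *)
From HB Require Import structures.
Require Import Defs.
From mathcomp Require Import all_boot all_order all_algebra.
From mathcomp Require Import all_classical all_reals all_analysis.
From mathcomp Require Import ring.

Set Implicit Arguments.
Unset Strict Implicit.
Unset Printing Implicit Defensive.

Import Order.TTheory GRing.Theory Num.Theory.
Import numFieldNormedType.Exports.

Local Open Scope classical_set_scope.
Local Open Scope ring_scope.

(** * Integrals over the unit interval *)

Section integral01.
Variable R : realType.
Implicit Types f g : R -> R.

Definition int01 f : R := Rintegral lebesgue_measure `[0, 1]%classic f.

Let integrable01 f :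
  (forall t : R, `[0, 1]%classic t -> {for t, continuous f}) ->
  integrable lebesgue_measure `[0, 1]%classic (EFin \o f).
Proof.
move=> cf; apply: continuous_compact_integrable; first exact: segment_compact.
by apply: continuous_in_subspaceT => t; rewrite inE; exact: cf.
Qed.

Lemma int01_cst a : int01 (fun=> a) = a.
Proof.
rewrite /int01 Rintegral_cst//= lebesgue_measure_itv/= lte01.
by rewrite oppr0 adde0 mulr1.
Qed.

Lemma int01D f g :
  (forall t : R, `[0, 1]%classic t -> {for t, continuous f}) ->
  (forall t : R, `[0, 1]%classic t -> {for t, continuous g}) ->
  int01 (fun t => f t + g t) = int01 f + int01 g.
Proof. by move=> cf cg; rewrite /int01 RintegralD//; exact: integrable01. Qed.

Lemma int01Z f a :
  (forall t : R, `[0, 1]%classic t -> {for t, continuous f}) ->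
  int01 (fun t => a * f t) = a * int01 f.
Proof. by move=> cf; rewrite /int01 RintegralZl//; exact: integrable01. Qed.

Lemma int01B f g :
  (forall t : R, `[0, 1]%classic t -> {for t, continuous f}) ->
  (forall t : R, `[0, 1]%classic t -> {for t, continuous g}) ->
  int01 (fun t => f t - g t) = int01 f - int01 g.
Proof. by move=> cf cg; rewrite /int01 RintegralB//; exact: integrable01. Qed.

Lemma int01_sum n (F : 'I_n -> R -> R) :
  (forall j (t : R), `[0, 1]%classic t -> {for t, continuous (F j)}) ->
  int01 (fun t => \sum_j F j t) = \sum_j int01 (F j).
Proof.
elim: n F => [|n IH] F cF.
  under eq_fun do rewrite big_ord0.
  by rewrite big_ord0 int01_cst.
under eq_fun do rewrite big_ord_recl.
rewrite big_ord_recl int01D ?IH//; first by move=> j; exact: cF.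
  exact: cF.
move=> t t01; apply: cvg_big => [|j _]; last exact: cF.
exact: add_continuous.
Qed.

Lemma int01_le f (M : R) :
  (forall t : R, `[0, 1]%classic t -> {for t, continuous f}) ->
  (forall t : R, `[0, 1]%classic t -> `|f t| <= M) -> `|int01 f| <= M.
Proof.
move=> cf fM; apply: le_trans (le_normr_Rintegral _ _) _ => //.
  exact: integrable01.
rewrite -[leRHS](int01_cst M).
apply: le_Rintegral => //; last by apply: integrable01 => t _; exact: cvg_cst.
apply: integrable01 => t t01.
by apply: continuous_comp (@norm_continuous _ _ _); exact: cf.
Qed.

Lemma int01_FTC f g :
  (forall t : R, `[0, 1]%classic t -> {for t, continuous g}) ->
  (forall t : R, `[0, 1]%classic t -> is_derive t 1 (f : R -> R^o) (g t)) ->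
  f 1 - f 0 = int01 g.
Proof.
move=> cg df.
(* Two-sided derivatives on the closed interval supply the endpoint limits that [continuous_FTC2]
   asks for. *)
have cf t : `[0, 1]%classic t -> {for t, continuous f}.
  by move=> /df[dft _]; exact/differentiable_continuous/derivable1_diffP.
rewrite /int01 /Rintegral (@continuous_FTC2 _ g f)//.
- by apply: continuous_in_subspaceT => t; rewrite inE; exact: cg.
- split.
  + move=> t t01; have [|] := df t => //.
    by rewrite /= in_itv/= !ltW ?(itvP t01).
  + by apply: cvg_at_right_filter; apply: cf; rewrite /= in_itv/= lexx ler01.
  + by apply: cvg_at_left_filter; apply: cf; rewrite /= in_itv/= lexx ler01.
- move=> t t01; rewrite derive1E; have [|_ ->//] := df t.
  by rewrite /= in_itv/= !ltW ?(itvP t01).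
Qed.

End integral01.

(** * Differentiability of functions of row vectors *)

Section row_calculus.
Variables (R : realType) (n : nat).
Local Notation pder j f := ('D_('e_j) (f : 'rV[R]_n -> R^o)).
Implicit Types (f : 'rV[R]_n -> R) (a x y h : 'rV[R]_n).

Lemma ler_norm_coord h j : `|h 0 j| <= `|h|.
Proof.
have /mapP[i Hi ->] : `|h 0 j| \in [seq `|h i.1 i.2| | i : 'I_1 * 'I_n].
  by apply/mapP; exists (0, j) => //=; rewrite mem_enum.
rewrite [leRHS]/Num.norm /= mx_normrE.
by apply/bigmax_geP; right => /=; exists i.
Qed.

Lemma norm_row_comb h (c : 'I_n -> R) (M : R) : (forall j, `|c j| <= M) ->
  `|\sum_j h 0 j * c j| <= n%:R * M * `|h|.
Proof.
move=> cM; apply: le_trans (ler_norm_sum _ _ _) _.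
apply: le_trans (ler_sum _ (G := fun=> M * `|h|) _) _.
  move=> j _; rewrite normrM mulrC.
  apply: ler_pM => //; exact: ler_norm_coord.
by rewrite sumr_const card_ord -mulrA mulr_natl.
Qed.

(** The candidate differential is continuous, being a finite sum of multiples of coordinates, so the
    estimate is the Landau expansion that characterises it. The epsilon form is used because such
    estimates can be integrated over a parameter. *)
Lemma differentiable_row_comb (c : 'I_n -> R) f x :
  (forall e : R, 0 < e -> \forall h \near (0 : 'rV[R]_n),
     `|f (h + x) - f x - \sum_j h 0 j * c j| <= e * `|h|) ->
  differentiable (f : 'rV[R]_n -> R^o) x /\
  forall v, 'D_v (f : 'rV[R]_n -> R^o) x = \sum_j v 0 j * c j.
Proof.
move=> fc; pose l (h : 'rV[R]_n) : R^o := \sum_j h 0 j * c j.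
have ll : linear l.
  move=> b u v; rewrite /l scaler_sumr -big_split; apply: eq_bigr => j _ /=.
  by rewrite !mxE mulrDl -mulrA.
pose L := HB.pack_for {linear 'rV[R]_n -> R^o} l
  (GRing.isLinear.Build _ _ _ _ l ll).
have cL : continuous L.
  move=> y; apply: (@cvg_big _ _ _ _ _ _ _ (nbhs y) _
    (fun j (h : 'rV[R]_n) => h 0 j * c j)).
    exact: add_continuous.
  move=> j _.
  by apply: cvgM; [exact: coord_continuous|exact: cvg_cst].
have fo : ((f : 'rV[R]_n -> R^o) \o shift x =
    cst (f x : R^o) + (L : 'rV[R]_n -> R^o) +o_ (0 : 'rV[R]_n) id).
  apply/eqaddoP => _ /posnumP[e].
  apply: filterS (fc _ (gt0 e)) => h; rewrite !fctE /= /shift /=.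
  by rewrite opprD addrA.
have dE := diff_unique cL fo.
have df : differentiable (f : 'rV[R]_n -> R^o) x.
  by apply/diff_locallyP; rewrite dE.
by split=> // v; rewrite deriveE// dE.
Qed.

Lemma derive_row_comb f x v : differentiable (f : 'rV[R]_n -> R^o) x ->
  'D_v (f : 'rV[R]_n -> R^o) x =
  \sum_j v 0 j * pder j f x.
Proof.
move=> df; rewrite deriveE// {1}(row_sum_delta v) linear_sum.
by apply: eq_bigr => j _; rewrite linearZ/= -deriveE.
Qed.

Lemma is_derive_line f a v t :
  differentiable (f : 'rV[R]_n -> R^o) (a + t *: v) ->
  is_derive t 1 (fun s : R => f (a + s *: v))
    ('D_v (f : 'rV[R]_n -> R^o) (a + t *: v)).
Proof.
move=> df.
have E :
    (fun h : R => h^-1 *: (((fun s : R => f (a + s *: v) : R^o) \o shift t)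
      (h *: (1 : R)) - f (a + t *: v))) =
    (fun h : R => h^-1 *: (((f : 'rV[R]_n -> R^o) \o shift (a + t *: v))
      (h *: v) - f (a + t *: v))).
  apply/funext => h /=; congr (_ *: (f _ - _)).
  by rewrite /shift /= scalerDl [h *: 1]mulr1 addrCA.
have dd : derivable (f : 'rV[R]_n -> R^o) (a + t *: v) v.
  exact: diff_derivable.
by split; rewrite /derivable /derive E.
Qed.

(** Compactness of the unit interval: neighbourhoods of [a] found locally in [t] combine into one
    that serves every [t]. *)
Lemma near_segment (P : 'rV[R]_n -> R -> Prop) a :
  (forall t : R, `[0, 1]%classic t -> \forall s \near t & y \near a,
     `[0, 1]%classic s -> P y s) ->
  \forall y \near a, forall t : R, `[0, 1]%classic t -> P y t.
Proof.
have /compact_near_coveringP/near_covering_withinP := @segment_compact R 0 1.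
by move=> /(_ _ (nbhs a) P (nbhs_filter a)).
Qed.

(** The mean value theorem on the segment from [y] to [h + y] produces partial derivatives at an
    intermediate point, which continuity at [a] keeps close to those at [y]. Letting [y] vary along
    with [h] makes the bound usable uniformly along a ray. *)
Lemma C1_near U f a : open U -> Ck 1 U f -> U a -> forall e : R, 0 < e ->
  \forall y \near a & h \near (0 : 'rV[R]_n),
    `|f (h + y) - f y - \sum_j h 0 j * pder j f y|
      <= e * `|h|.
Proof.
move=> oU [df Df] Ua e e0.
(* The [n] coordinates each contribute a deviation of at most [2 * d], and the total must stay below
   [e]; [n.+1] keeps the denominator nonzero when [n = 0]. *)
pose d := e / (2 * n.+1%:R).
have d0 : 0 < d by rewrite divr_gt0// mulr_gt0.
have : \forall z \near a, U z /\ forall j,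
    `|pder j f z - pder j f a| < d.
  apply: filterI; first exact: open_nbhs_nbhs.
  have FF : Filter (nbhs a) by exact: nbhs_filter.
  apply: (filter_forall FF) => j.
  by have /(@cvgr_distC_lt _ R^o) := Df 'e_j a Ua; apply.
move=> /nbhs_ballP[r /= r0 rP].
(* Halving both radii keeps the whole segment from [y] to [y + h] in the ball of radius [r]. *)
exists (ball a (r / 2), ball 0 (r / 2)).
  by split; apply/nbhs_ballP; exists (r / 2) => //=; rewrite divr_gt0.
move=> [y h] [/= ay h0].
have seg (t : R) : t \in `[0, 1]%R -> ball a r (y + t *: h).
  rewrite in_itv/= => /andP[t0 t1].
  move: ay h0; rewrite -!ball_normE /ball_ /= sub0r normrN => ay h0.
  rewrite opprD addrA; apply: le_lt_trans (ler_normB _ _) _.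
  rewrite [ltRHS]splitr; apply: ltrD => //.
  apply: le_lt_trans h0; rewrite normrZ ger0_norm//.
  by rewrite ler_piMl.
pose g (s : R) : R := f (y + s *: h).
pose g' (t : R) : R := 'D_h (f : 'rV[R]_n -> R^o) (y + t *: h).
have dl (t : R) : t \in `[0, 1]%R -> is_derive t 1 g (g' t).
  by move=> /seg /rP[Ut _]; apply/is_derive_line/df.
have dloo (t : R) : t \in `]0, 1[%R -> is_derive t 1 g (g' t).
  by move=> t01; apply: dl; apply: subset_itv_oo_cc t01.
have cg : {within `[0, 1], continuous g}.
  by apply: derivable_within_continuous => t t01; have [] := dl t t01.
have [c c01] := MVT_segment ler01 dloo cg.
rewrite /g /g' scale1r scale0r addr0 subr0 mulr1 [h + y]addrC => ->.
have [Uc cP] := rP _ (seg _ c01).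
have [_ yP] : U y /\ forall j,
    `|pder j f y - pder j f a| < d.
  apply: rP; have := seg 0; rewrite scale0r addr0; apply.
  by rewrite in_itv/= lexx ler01.
rewrite (derive_row_comb _ (df _ Uc)) -sumrB.
under eq_bigr do rewrite -mulrBr.
apply: le_trans (norm_row_comb (M := 2 * d) _ _) _ => [j|].
  rewrite -(subrKA (pder j f a)).
  apply: le_trans (ler_normD _ _) _; rewrite mulr_natl mulr2n lerD//.
    exact/ltW.
  by rewrite distrC; exact/ltW.
apply: ler_wpM2r => //.
rewrite /d; have n1 : (n.+1%:R : R) != 0 by rewrite pnatr_eq0.
rewrite (_ : n%:R * _ = e * (n%:R / n.+1%:R)); last by field.
by apply: ler_piMr; [exact: ltW|rewrite ler_pdivrMr// mul1r ler_nat].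
Qed.

End row_calculus.

(** * Ray integrals and Hadamard's lemma *)

Section hadamard.
Variables (R : realType) (n : nat) (a : 'rV[R]_n) (U : set 'rV[R]_n).
Hypothesis oU : open U.
Hypothesis starU : forall x (t : R), U x -> `[0, 1]%classic t ->
  U (a + t *: (x - a)).
Local Notation pder j f := ('D_('e_j) (f : 'rV[R]_n -> R^o)).
Implicit Types (f : 'rV[R]_n -> R) (x y : 'rV[R]_n) (k : nat).

(* The weight t^k makes this family of operators closed under
   differentiation. *)
Definition ray_int k f x : R := int01 (fun t => t ^+ k * f (a + t *: (x - a))).

Let continuous_ray x : continuous (fun t : R => a + t *: (x - a)).
Proof.
move=> t; apply: cvgD; first exact: cvg_cst.
by apply: cvgZr_tmp; exact: cvg_id.
Qed.

Let continuous_integrand k f x : Ck 0 U f -> U x ->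
  forall t : R, `[0, 1]%classic t ->
  {for t, continuous (fun t : R => t ^+ k * f (a + t *: (x - a)))}.
Proof.
move=> cf Ux t t01; apply: cvgM; first exact: exprn_continuous.
apply: (@continuous_comp _ _ _ (fun t : R => a + t *: (x - a)) f t).
  exact: continuous_ray.
exact/cf/starU.
Qed.

(** By compactness the values of [f] along the rays to [y] and to [x] are uniformly close, and the
    weight is at most 1, so the bound passes to the integrals. *)
Lemma ray_int_continuous k f : Ck 0 U f -> Ck 0 U (ray_int k f).
Proof.
move=> cf x Ux; apply/(@cvgrPdist_le _ R^o _ (nbhs x)) => e e0.
have : \forall y \near x, forall t : R, `[0, 1]%classic t ->
    `|f (a + t *: (y - a)) - f (a + t *: (x - a))| <= e.
  apply: near_segment => t t01.
  have cr : (fun ty : R * 'rV[R]_n => a + ty.1 *: (ty.2 - a)) @ (t, x) -->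
      a + t *: (x - a).
    apply: cvgD; first exact: cvg_cst.
    apply: cvgZ; first exact: cvg_fst.
    by apply: cvgB; [exact: cvg_snd|exact: cvg_cst].
  have e20 : 0 < e / 2 by rewrite divr_gt0.
  have fe : \forall z \near a + t *: (x - a),
      `|f (a + t *: (x - a)) - f z| < e / 2.
    by have /(@cvgr_dist_lt _ R^o) := cf _ (starU Ux t01); apply.
  have [[A B] [/= At Bx] AB] := cr _ fe.
  exists (A, B) => // -[s y] [/= As By] _.
  (* Both values at time [s] are within [e / 2] of the value at time [t] on the ray to [x]. *)
  rewrite -(subrKA (f (a + t *: (x - a)))) [leRHS]splitr.
  apply: le_trans (ler_normD _ _) _; apply: lerD; apply/ltW.
    rewrite distrC; exact: (AB (s, y)).
  by apply: (AB (s, x)); split=> //=; exact: nbhs_singleton.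
have := open_nbhs_nbhs (conj oU Ux).
apply: filterS2 => y Uy ye.
have cy := continuous_integrand (k := k) cf Uy.
have cx := continuous_integrand (k := k) cf Ux.
rewrite /ray_int distrC -int01B//; apply: int01_le => t t01.
  by apply: cvgB; [exact: cy|exact: cx].
rewrite -mulrBr normrM; apply: le_trans (ye t t01).
move: t01; rewrite /= in_itv/= => /andP[t0 t1].
by rewrite ler_piMl// normrX exprn_ile1// ger0_norm.
Qed.

(** Differentiation under the integral sign: moving the endpoint by [h] moves the point at time [t]
    by [t *: h], and this factor [t] raises the weight from [k] to [k.+1]. *)
Lemma ray_int_near k f x : Ck 1 U f -> U x ->
  forall e : R, 0 < e -> \forall h \near (0 : 'rV[R]_n),
    `|ray_int k f (h + x) - ray_int k f x -
      \sum_j h 0 j * ray_int k.+1 (pder j f) x|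
    <= e * `|h|.
Proof.
move=> Cf Ux e e0; have [df Df] := Cf.
have c0f : Ck 0 U f := CkW Cf.
(* [C1_near] is applied at each point of the ray, with an increment [t *: h] no longer than [h];
   [near_segment] makes the result uniform in [t]. *)
have : \forall h \near (0 : 'rV[R]_n), forall t : R, `[0, 1]%classic t ->
      `|f (t *: h + (a + t *: (x - a))) - f (a + t *: (x - a)) -
      \sum_j (t *: h) 0 j * pder j f (a + t *: (x - a))|
      <= e * `|h|.
  apply: near_segment => t t01.
  have [[A B] [/= Ax B0] AB] := C1_near oU Cf (starU Ux t01) e0.
  have cr : (fun sh : R * 'rV[R]_n => sh.1 *: sh.2) @ (t, 0 : 'rV[R]_n) -->
      t *: (0 : 'rV[R]_n).
    by apply: cvgZ; [exact: cvg_fst|exact: cvg_snd].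
  rewrite scaler0 in cr.
  have [[C D] [/= Ct D0] CD] := cr _ B0.
  exists ((fun s => A (a + s *: (x - a))) `&` C, D) => /=.
    by split=> //; apply: filterI => //; exact: continuous_ray Ax.
  move=> [s h] [/= [As Cs] Dh].
  rewrite /= in_itv/= => /andP[s0 s1].
  apply: le_trans (AB (_, _) _) _; first by split=> //; exact: (CD (s, h)).
  by rewrite /= ler_pM2l// normrZ ger0_norm// ler_piMl.
have : \forall h \near (0 : 'rV[R]_n), U (h + x).
  have : {for (0 : 'rV[R]_n), continuous (fun h : 'rV[R]_n => h + x)}.
    by apply: continuousD; [exact: cvg_id|exact: cst_continuous].
  by rewrite /prop_for /continuous_at add0r; apply; exact: open_nbhs_nbhs.
apply: filterS2 => h Uhx hP.
have cD j : Ck 0 U (pder j f) by exact: Df.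
have cx := continuous_integrand (k := k) c0f Ux.
have chx := continuous_integrand (k := k) c0f Uhx.
have cDx j := continuous_integrand (k := k.+1) (cD j) Ux.
have cs (t : R) : `[0, 1]%classic t -> {for t, continuous (fun t : R =>
    \sum_j h 0 j * (t ^+ k.+1 * pder j f (a + t *: (x - a))))}.
  move=> t01; apply: cvg_big => [|j _]; first exact: add_continuous.
  by apply: cvgM; [exact: cvg_cst|exact: cDx].
rewrite /ray_int (eq_bigr _ (fun j _ => esym (int01Z (h 0 j) (cDx j)))).
rewrite -int01_sum//; last first.
  by move=> j t t01; apply: cvgM; [exact: cvg_cst|exact: cDx].
have cd (t : R) : `[0, 1]%classic t -> {for t, continuous (fun t : R =>
    t ^+ k * f (a + t *: (h + x - a)) - t ^+ k * f (a + t *: (x - a)))}.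
  by move=> t01; apply: cvgB; [exact: chx|exact: cx].
rewrite -int01B// -int01B//; apply: int01_le => t t01.
  by apply: cvgB; [exact: cd|exact: cs].
have := hP t t01; rewrite (_ : t *: h + _ = a + t *: (h + x - a)); last first.
  by rewrite addrCA -scalerDr addrA.
apply: le_trans.
have -> : \sum_j h 0 j * (t ^+ k.+1 * pder j f (a + t *: (x - a)))
    = t ^+ k * \sum_j (t *: h) 0 j * pder j f (a + t *: (x - a)).
  by rewrite mulr_sumr; apply: eq_bigr => j _; rewrite !mxE exprSr; ring.
rewrite -!mulrBr normrM.
move: t01; rewrite /= in_itv/= => /andP[t0 t1].
by rewrite ler_piMl// normrX exprn_ile1// ger0_norm.
Qed.

(** By [ray_int_near] the directional derivatives are combinations of ray integrals of partial
    derivatives with weight [k.+1]; hence an induction on [j] for all [k] and [f] at once. *)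
Lemma Ck_ray_int j k f : Ck j U f -> Ck j U (ray_int k f).
Proof.
elim: j k f => [|j IH] k f; first exact: ray_int_continuous.
move=> Cf; have C1f : Ck 1 U f.
  by case: Cf => df Df; split=> // v; elim: (j) (Df v) => // i IHi /CkW.
have [df Df] := Cf.
have H x (Ux : U x) := differentiable_row_comb (ray_int_near k C1f Ux).
split=> [x /H[]//|v].
apply: (@Ck_ext _ _ _ _ (fun x => \sum_i v 0 i *
    ray_int k.+1 (pder i f) x)) => //.
  by move=> x /H[_ ->].
apply: Ck_sum => // i; apply: CkM => //; first exact: Ck_cst.
exact/IH/Df.
Qed.

(** This is the fundamental theorem of calculus on the ray from [a] to [x], with the derivative
    along the ray expanded in partial derivatives. *)
Lemma ray_int_sum f x : Ck 1 U f -> U x ->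
  f x = f a + \sum_j (x 0 j - a 0 j) *
    ray_int 0 (pder j f) x.
Proof.
move=> Cf Ux; have [df Df] := Cf.
have cx j := continuous_integrand (k := 0) (Df 'e_j) Ux.
have cs (t : R) : `[0, 1]%classic t -> {for t, continuous (fun t : R =>
    \sum_j (x 0 j - a 0 j) * (t ^+ 0 * pder j f (a + t *: (x - a))))}.
  move=> t01; apply: cvg_big => [|j _]; first exact: add_continuous.
  by apply: cvgM; [exact: cvg_cst|exact: cx].
have := int01_FTC (f := fun t : R => f (a + t *: (x - a))) cs.
rewrite scale1r scale0r addr0 subrKC int01_sum; last first.
  by move=> j t t01; apply: cvgM; [exact: cvg_cst|exact: cx].
rewrite (eq_bigr _ (fun j _ => int01Z (x 0 j - a 0 j) (cx j))).
move=> E; apply/eqP; rewrite addrC -subr_eq; apply/eqP; apply: E.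
move=> t t01; have dft := df _ (starU Ux t01).
apply: is_derive_eq (is_derive_line dft) _.
rewrite derive_row_comb//; apply: eq_bigr => j _.
by rewrite expr0 mul1r !mxE.
Qed.

End hadamard.

(** On a ball, which is star-shaped about its centre, the ray integrals of the partial derivatives
    with weight 0 serve as [g]; at [a] the integrand is constant, which gives [g j a]. *)
Lemma smooth_near_hadamard (R : realType) n (f : 'rV[R]_n -> R) a :
  smooth_near f a -> exists g : 'I_n -> 'rV[R]_n -> R,
  [/\ forall j, smooth_near (g j) a,
      forall j, g j a = 'D_('e_j) (f : 'rV[R]_n -> R^o) a &
      \forall x \near a, f x = f a + \sum_j (x 0 j - a 0 j) * g j x].
Proof.
move=> [U [oU Ua] Cf].
have /nbhs_ballP[r /= r0 rU] := open_nbhs_nbhs (conj oU Ua).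
have ob : open (ball a r) by exact: ball_open.
have CB k : Ck k (ball a r) f by exact: Ck_sub (Cf k).
have star x (t : R) : ball a r x -> `[0, 1]%classic t ->
    ball a r (a + t *: (x - a)).
  rewrite -ball_normE /ball_ /= in_itv/= => ax /andP[t0 t1].
  rewrite opprD addrA subrr sub0r normrN normrZ ger0_norm// distrC.
  by apply: le_lt_trans ax; rewrite ler_piMl.
exists (fun j => ray_int a 0 ('D_('e_j) (f : 'rV[R]_n -> R^o))); split=> [j|j|].
- exists (ball a r) => [|k]; first by split=> //; exact: ballxx.
  by apply: Ck_ray_int => //; have [_] := CB k.+1; apply.
- rewrite /ray_int subrr.
  under eq_fun do rewrite scaler0 addr0 expr0 mul1r.
  exact: int01_cst.
- apply: filterS (nbhsx_ballx a r r0) => x ax.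
  exact: (ray_int_sum star (CB 1%N) ax).
Qed.

(** * Smoothness of derivatives and of block rows *)

Section smooth_near_derive.
Variables (R : realType) (n : nat).
Implicit Types (f : 'rV[R]_n -> R) (x v : 'rV[R]_n).

Lemma smooth_near_differentiable f x :
  smooth_near f x -> differentiable (f : 'rV[R]_n -> R^o) x.
Proof. by move=> [U [oU Ux] /(_ 1%N)[df _]]; exact: df. Qed.

Lemma smooth_near_derive f x v :
  smooth_near f x -> smooth_near ('D_v (f : 'rV[R]_n -> R^o)) x.
Proof. by move=> [U oU Cf]; exists U => // k; have [_] := Cf k.+1; apply. Qed.

Lemma smooth_near_row_mxr m (a : 'rV[R]_m) x :
  smooth_map_near (fun y => row_mx a y) x.
Proof.
move=> j; case: (split_ordP j) => i ->.
  by under eq_fun do rewrite row_mxEl; exact: smooth_near_cst.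
by under eq_fun do rewrite row_mxEr; exact: smooth_near_coord.
Qed.

Lemma smooth_near_row_mxl m (a : 'rV[R]_m) x :
  smooth_map_near (fun y => row_mx y a) x.
Proof.
move=> j; case: (split_ordP j) => i ->.
  by under eq_fun do rewrite row_mxEl; exact: smooth_near_coord.
by under eq_fun do rewrite row_mxEr; exact: smooth_near_cst.
Qed.

Lemma derive_row_mxr m (F : 'rV[R]_(n + m) -> R) x (y v : 'rV[R]_m) :
  'D_v (fun z => F (row_mx x z) : R^o) y =
  'D_(row_mx 0 v) (F : 'rV[R]_(n + m) -> R^o) (row_mx x y).
Proof.
rewrite /derive; set f := (fun _ : R => _); set g := (fun _ : R => _).
suff -> : f = g by [].
apply/funext => t; rewrite /f /g /= scale_row_mx scaler0 add_row_mx add0r.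
by [].
Qed.

Lemma delta_rshift m (i : 'I_m) :
  'e_(rshift n i) = row_mx 0 'e_i :> 'rV[R]_(n + m).
Proof.
apply/rowP => j; case: (split_ordP j) => l ->.
  by rewrite row_mxEl !mxE eqxx eq_lrshift.
by rewrite row_mxEr !mxE eqxx eq_rshift.
Qed.

End smooth_near_derive.

(** * Tangent vectors and coordinate derivations *)

Section tangent_vectors.
Variables (R : realType) (n : nat) (M : manifoldType R n).
Implicit Types (p : M) (f g : M -> R).

Lemma smooth_fun_at_sum (I : finType) (F : I -> M -> R) p :
  (forall i, smooth_fun_at p (F i)) -> smooth_fun_at p (fun q => \sum_i F i q).
Proof.
move=> sF; elim: (index_enum I) => [|i s IH].
  by under eq_fun do rewrite big_nil; exact: smooth_fun_at_cst.
by under eq_fun do rewrite big_cons; exact: smooth_fun_atD.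
Qed.

Lemma smooth_fun_atZ p (a : R) f :
  smooth_fun_at p f -> smooth_fun_at p (fun q => a * f q).
Proof. by apply: smooth_fun_atM; exact: smooth_fun_at_cst. Qed.

(** Off the functions smooth at [p] both sides vanish by [derivation0], so smooth test functions
    suffice. *)
Lemma tangent_eqP p (u v : tangent p) :
  (forall f, smooth_fun_at p f -> u f = v f) -> u = v.
Proof.
move=> uv; apply/val_inj/funext => f /=.
have [/uv//|nsf] := pselect (smooth_fun_at p f).
by rewrite (derivation0 (tangentP u))// (derivation0 (tangentP v)).
Qed.

Lemma tangentPE p (a : R) (u v : tangent p) f :
  (a *: u + v) f = a * u f + v f.
Proof. by []. Qed.

Lemma tangent_sumE p (I : finType) (F : I -> tangent p) f :
  (\sum_i F i : tangent p) f = \sum_i F i f.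
Proof. by elim/big_ind2: _ => // u a v b <- <-. Qed.

Section derivation.
Variables (p : M) (v : tangent p).

(** Leibniz on [1 * 1] shows that [v] kills the constant 1; then [a] is read as [(a - 1) * 1 + 1] to
    fit the linearity law. *)
Lemma derivation_cst (a : R) : v (fun=> a) = 0.
Proof.
have [_ _ vl vL] := tangentP v.
have s1 := smooth_fun_at_cst p (1 : R).
have v1 : v (fun=> 1) = 0.
  have := vL _ _ s1 s1; rewrite !mul1r.
  by move=> /eqP; rewrite addrC -subr_eq subrr eq_sym => /eqP.
have := vl (a - 1) _ _ s1 s1; under eq_fun do rewrite mulr1 subrK.
by rewrite v1 mulr0 addr0.
Qed.

Lemma derivationD f g : smooth_fun_at p f -> smooth_fun_at p g ->
  v (fun q => f q + g q) = v f + v g.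
Proof.
move=> sf sg; have := derivation_linear (tangentP v) 1 sf sg.
by under eq_fun do rewrite mul1r; rewrite mul1r.
Qed.

Lemma derivationZ (a : R) f : smooth_fun_at p f ->
  v (fun q => a * f q) = a * v f.
Proof.
move=> sf; have := derivation_linear (tangentP v) a sf (smooth_fun_at_cst p 0).
by under eq_fun do rewrite addr0; rewrite derivation_cst addr0.
Qed.

Lemma derivation_sum (I : finType) (F : I -> M -> R) :
  (forall i, smooth_fun_at p (F i)) ->
  v (fun q => \sum_i F i q) = \sum_i v (F i).
Proof.
move=> sF; suff : smooth_fun_at p (fun q => \sum_i F i q) /\
  v (fun q => \sum_i F i q) = \sum_i v (F i) by case.
elim: (index_enum I) => [|i s [sIH IH]].
  under eq_fun do rewrite big_nil; rewrite big_nil.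
  by rewrite derivation_cst; split=> //; exact: smooth_fun_at_cst.
under eq_fun do rewrite big_cons; rewrite big_cons.
by rewrite derivationD// IH; split=> //; exact: smooth_fun_atD.
Qed.

End derivation.

Section coordinate_vectors.
Variables (p : M) (c : chart R n M).
Hypotheses (Ac : atlas c) (cp : cdom c p).

Lemma smooth_fun_at_chart (g : 'rV[R]_n -> R) :
  smooth_near g (c p) -> smooth_fun_at p (g \o c).
Proof.
move=> sg; exists c; split=> //; apply: smooth_near_ext sg.
by apply: filterS (ccod_near cp) => x cx /=; rewrite cinvK.
Qed.

(** The coordinate derivation of the chart [c] at [p], with the value 0 that [derivation0] demands
    elsewhere. *)
Definition partial (j : 'I_n) f : R^o :=
  if `[< smooth_fun_at p f >]
  then 'D_('e_j) (f \o cinv c : 'rV[R]_n -> R^o) (c p) else 0.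

Lemma partial_derivation j : point_derivationb p (partial j).
Proof.
have dif f : smooth_fun_at p f ->
    derivable (f \o cinv c : 'rV[R]_n -> R^o) (c p) 'e_j.
  move=> /(smooth_fun_atE _ Ac cp) sf.
  exact/diff_derivable/smooth_near_differentiable.
apply/asboolP; rewrite /partial.
split=> [f nsf|f g sf fg|a f g sf sg|f g sf sg].
- by rewrite asboolF.
- rewrite !asboolT//; last exact: smooth_fun_at_ext sf.
  by apply: near_eq_derive; exact: (cinv_near cp fg).
- rewrite !asboolT//; last first.
    by apply: smooth_fun_atD => //; exact: smooth_fun_atZ.
  rewrite -[RHS]/(a *: _ + _) -deriveZ; last exact: dif.
  by rewrite -deriveD//; [exact/derivableZ/dif|exact: dif].
- rewrite !asboolT//; last exact: smooth_fun_atM.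
  have := deriveM (dif _ sf) (dif _ sg).
  by rewrite /= (cmapK cp).
Qed.

Definition coordinate_vector j : tangent p := Tangent (partial_derivation j).

Lemma coordinate_vectorE j f : smooth_fun_at p f ->
  coordinate_vector j f = 'D_('e_j) (f \o cinv c : 'rV[R]_n -> R^o) (c p).
Proof. by move=> sf; rewrite /= /partial asboolT. Qed.

Lemma smooth_fun_at_coordinate j : smooth_fun_at p (fun q => c q 0 j).
Proof.
exact: (smooth_fun_at_chart (g := fun x => x 0 j)) (smooth_near_coord _ _).
Qed.

(** Hadamard's lemma in the chart writes [f] near [p] as a constant plus products whose first factor
    [c q 0 j - c p 0 j] vanishes at [p]. Leibniz then leaves only the derivative of that factor
    times [g j (c p)], a partial derivative of [f]. *)
Lemma tangent_coordinates (v : tangent p) :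
  v = \sum_j v (fun q => c q 0 j) *: coordinate_vector j.
Proof.
apply: tangent_eqP => f sf; rewrite tangent_sumE.
have [/(_ sf)/smooth_near_hadamard[g [sg gE fE]] _] := smooth_fun_atE f Ac cp.
have sgc j : smooth_fun_at p (fun q => g j (c q)).
  exact: (smooth_fun_at_chart (sg j)).
have sd j : smooth_fun_at p (fun q => c q 0 j - c p 0 j).
  apply: smooth_fun_atD; first exact: smooth_fun_at_coordinate.
  exact: smooth_fun_at_cst.
have sm j : smooth_fun_at p (fun q => (c q 0 j - c p 0 j) * g j (c q)).
  exact: smooth_fun_atM.
have fE' : \forall q \near p,
    f q = f p + \sum_j (c q 0 j - c p 0 j) * g j (c q).
  apply: filterS2 (cdom_near cp) (cmap_near cp fE) => q cq.
  by rewrite /= !cmapK.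
rewrite (derivation_germ (tangentP v) sf fE') derivationD; last 2 first.
- exact: smooth_fun_at_cst.
- exact: smooth_fun_at_sum.
rewrite derivation_cst add0r derivation_sum//; apply: eq_bigr => j _.
rewrite (derivation_leibniz (tangentP v) (sd j) (sgc j)) subrr mul0r add0r.
rewrite derivationD; last 2 first.
- exact: smooth_fun_at_coordinate.
- exact: smooth_fun_at_cst.
rewrite derivation_cst addr0 gE mulrC.
by rewrite -[RHS]/(v _ * coordinate_vector j f) coordinate_vectorE.
Qed.

End coordinate_vectors.
End tangent_vectors.

(** A chart-free criterion, from which stability under composition is immediate. For the converse,
    the coordinate functions of one chart at [F p] are pulled back. *)
Lemma smooth_atP (R : realType) n m (M : manifoldType R n)
    (N : manifoldType R m) (F : M -> N) p : smooth_at F p <->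
  {for p, continuous F} /\
  forall f, smooth_fun_at (F p) f -> smooth_fun_at p (f \o F).
Proof.
split=> [sF|[cF sF]].
  by split=> [|f]; [case: sF|exact: smooth_fun_at_comp].
split=> //.
have [c Ac cp] := atlas_cover p; have [d Ad dp] := atlas_cover (F p).
exists c, d; split=> // j.
have := sF _ (smooth_fun_at_coordinate Ad dp j).
by move=> /(smooth_fun_atE _ Ac cp).
Qed.

Lemma smooth_at_comp (R : realType) n m l (M : manifoldType R n)
    (N : manifoldType R m) (P : manifoldType R l) (F : M -> N) (H : N -> P) p :
  smooth_at F p -> smooth_at H (F p) -> smooth_at (H \o F) p.
Proof.
move=> /smooth_atP[cF sF] /smooth_atP[cH sH]; apply/smooth_atP; split.
  exact: continuous_comp.
by move=> f /sH /sF.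
Qed.

(** * Partial tangent derivatives on products *)

Section product_slices.
Variables (R : realType) (n m : nat).
Variables (M : manifoldType R n) (N : manifoldType R m).

Lemma smooth_pairr (p : M) : smooth (fun q : N => (p, q)).
Proof.
move=> q; apply/smooth_atP; split.
  by apply: cvg_pair; [exact: cvg_cst|exact: cvg_id].
have [c Ac cp] := atlas_cover p; have [d Ad dq] := atlas_cover q.
have Acd : atlas (prod_chart c d) by exists (c, d).
move=> f /(smooth_fun_atE (p := (p, q)) _ Acd (conj cp dq)) sf.
exists d; split=> //.
have := smooth_near_comp (smooth_near_row_mxr (c p) (d q)) sf.
congr smooth_near; apply/funext => y /=.
by rewrite row_mxKl row_mxKr cmapK.
Qed.

(** Expanded in coordinate vectors at the fixed point [q], [u] has coefficients independent of [p'];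
    what varies are partial derivatives of the local expression of [F] along the second block, which
    are smooth. *)
Lemma smooth_fun_at_tangent (p : M) (q : N) (u : tangent q)
    (F : M * N -> R) : smooth_fun_at (p, q) F ->
  smooth_fun_at p (fun p' => u (fun q' => F (p', q'))).
Proof.
move=> sF; have [c Ac cp] := atlas_cover p; have [d Ad dq] := atlas_cover q.
have Acd : atlas (prod_chart c d) by exists (c, d).
have /(smooth_fun_atE (p := (p, q)) _ Acd (conj cp dq)) := sF.
set Phi := F \o _ => sPhi.
(* The local expression, in the chart [c], of the function to be shown smooth. *)
pose h x := \sum_i u (fun q' => d q' 0 i) *
  'D_('e_(rshift n i)) (Phi : 'rV[R]_(n + m) -> R^o) (row_mx x (d q)).
have sh : smooth_near h (c p).
  have sD i : smooth_near (fun x => u (fun q' => d q' 0 i) *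
      'D_('e_(rshift n i)) (Phi : 'rV[R]_(n + m) -> R^o)
        (row_mx x (d q))) (c p).
    apply: smooth_nearM; first exact: smooth_near_cst.
    apply: (smooth_near_comp (g := fun x => row_mx x (d q))
      (f := 'D_('e_(rshift n i)) (Phi : 'rV[R]_(n + m) -> R^o))).
      exact: smooth_near_row_mxl.
    exact: smooth_near_derive.
  rewrite /h; elim: (index_enum _) => [|i s IH].
    by under eq_fun do rewrite big_nil; exact: smooth_near_cst.
  by under eq_fun do rewrite big_cons; exact: smooth_nearD.
apply: smooth_fun_at_ext (smooth_fun_at_chart Ac cp sh).
have cpq : (fun p' : M => (p', q)) @ p --> (p, q).
  by apply: cvg_pair; [exact: cvg_id|exact: cvg_cst].
(* [coordinate_vectorE] needs the slice of [F] at [p'] to be smooth at [q], which holds for [p']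
   near [p] because smoothness at [(p, q)] spreads to a neighbourhood. *)
apply: filterS2 (cdom_near cp) (cpq _ (smooth_fun_at_near sF)) => p' cp' sF'.
have sF'q : smooth_fun_at q (fun q' => F (p', q')).
  exact: (smooth_fun_at_comp (@smooth_pairr p' q) sF').
rewrite [in RHS](tangent_coordinates Ad dq u) tangent_sumE.
apply: eq_bigr => i _.
rewrite -[RHS]/(u _ * coordinate_vector Ad dq i _) coordinate_vectorE//.
have -> : (fun q' => F (p', q')) \o cinv d = fun z => Phi (row_mx (c p') z).
  by apply/funext => z; rewrite /Phi /= row_mxKl row_mxKr cmapK.
by rewrite derive_row_mxr -delta_rshift.
Qed.

End product_slices.

(** * Finite-dimensional spaces and differentials of maps into them *)

Section finite_frames.
Variable R : realType.

(* The form in which finite dimensionality is used. *)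
Definition finite_frame (V : lmodType R) :=
  exists (I : finType) (b : I -> V) (k : I -> {scalar V}),
    forall v, v = \sum_i k i v *: b i.

Definition scalar_of (V : lmodType R) (f : V -> R) (sf : scalar f) :
    {scalar V} :=
  HB.pack_for {scalar V} f (GRing.isLinear.Build R V R *%R f sf).

Lemma gl_eqP (V : lmodType R) (A B : gl V) : (forall u, A u = B u) -> A = B.
Proof. by move=> AB; exact/val_inj/funext. Qed.

Lemma glPE (V : lmodType R) (a : R) (A B : gl V) u :
  (a *: A + B) u = a *: A u + B u.
Proof. by []. Qed.

Lemma gl_sumE (V : lmodType R) (I : finType) (F : I -> gl V) u :
  (\sum_i F i : gl V) u = \sum_i F i u.
Proof. by elim/big_ind2: _ => // A a B b <- <-. Qed.

Lemma gl_linear (V : lmodType R) (A : gl V) : linear A.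
Proof. exact/asboolP/gl_subproof. Qed.

Lemma gl_sum (V : lmodType R) (A : gl V) (I : finType) (a : I -> R)
    (b : I -> V) :
  A (\sum_i a i *: b i) = \sum_i a i *: A (b i).
Proof.
have A0 : A 0 = 0.
  have := gl_linear A (-1) 0 0; rewrite scaler0 addr0 scaleN1r => ->.
  by rewrite addNr.
elim: (index_enum I) => [|i s IH]; first by rewrite !big_nil.
by rewrite !big_cons gl_linear IH.
Qed.

Lemma tangent_frame n (M : manifoldType R n) (p : M) : finite_frame (tangent p).
Proof.
have [c Ac cp] := atlas_cover p.
have sc (i : 'I_n) : scalar (fun v : tangent p => v (fun q => c q 0 i)) by [].
exists 'I_n, (coordinate_vector Ac cp), (fun i => scalar_of (sc i)) => v.
exact: tangent_coordinates.
Qed.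

(** The combination of chart coordinates weighted by the values of [k] on the coordinate vectors
    serves as [f]. Questions about functionals thus become questions about derivations of smooth
    functions. *)
Lemma tangent_functional n (M : manifoldType R n) (p : M)
    (k : {scalar tangent p}) :
  exists2 f, smooth_fun_at p f & forall v, k v = v f.
Proof.
have [c Ac cp] := atlas_cover p.
have sc i := smooth_fun_at_coordinate Ac cp i.
exists (fun q => \sum_i k (coordinate_vector Ac cp i) * c q 0 i).
  by apply: smooth_fun_at_sum => i; exact: smooth_fun_atZ.
move=> v; rewrite derivation_sum; last by move=> i; exact: smooth_fun_atZ.
rewrite {1}(tangent_coordinates Ac cp v) linear_sum.
by apply: eq_bigr => i _; rewrite linearZ/= derivationZ// mulrC.
Qed.

(** Matrix units: [b (i, j)] sends [u] to [k i u *: e j], and its coefficient is the matrix entry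
    [k j (A (e i))]. *)
Lemma gl_frame (V : lmodType R) : finite_frame V -> exists (I : finType)
  (b : I * I -> gl V) (k : I -> {scalar V}) (e : I -> V),
  forall A : gl V, A = \sum_ij k ij.2 (A (e ij.1)) *: b ij.
Proof.
move=> [I [e [k kE]]].
have lE (ij : I * I) : linearb (fun u => k ij.1 u *: e ij.2).
  by apply/asboolP => a u v; rewrite linearP/= scalerDl scalerA.
exists I, (fun ij => Gl (lE ij)), k, e => A; apply: gl_eqP => u.
rewrite gl_sumE.
rewrite (eq_bigr (fun ij => k ij.1 u *: (k ij.2 (A (e ij.1)) *: e ij.2))).
  rewrite -(pair_bigA _ (fun i j => k i u *: (k j (A (e i)) *: e j))) /=.
  rewrite {1}(kE u) gl_sum; apply: eq_bigr => i _.
  by rewrite -scaler_sumr -kE.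
move=> ij _; rewrite -[LHS]/(_ *: (k ij.1 u *: e ij.2)).
by rewrite scalerA mulrC -scalerA.
Qed.

Section gl_valued.
Variables (n : nat) (M : manifoldType R n) (V : lmodType R) (F : M -> gl V).
Hypothesis fV : finite_frame V.
Hypothesis sF : forall (k : {scalar V}) u p,
  smooth_fun_at p (fun q => k (F q u)).

(** By [gl_frame] a functional on [gl V] is a fixed combination of matrix entries, and [sF] covers
    these. *)
Lemma smooth_vec_gl : smooth_vec F.
Proof.
move=> l p; have [I [b [k [e bE]]]] := gl_frame fV.
have := smooth_fun_at_sum (p := p) (fun ij : I * I =>
  smooth_fun_atM (smooth_fun_at_cst p (l (b ij))) (sF (k ij.2) (e ij.1) p)).
congr smooth_fun_at; apply/funext => q.
rewrite /= [in RHS](bE (F q)) linear_sum.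
by apply: eq_bigr => ij _; rewrite linearZ mulrC.
Qed.

Lemma vec_differential_glE p (x : tangent p) u (k : {scalar V}) :
  k (vec_differential F x u) = x (fun q => k (F q u)).
Proof.
have sl : scalar (fun A : gl V => k (A u)).
  by move=> a A B; rewrite glPE linearP.
(* It is enough to have the defining property of the differential for all functionals on [gl V], and
   then to use it at [A |-> k (A u)]. *)
suff /(_ (scalar_of sl)) : forall l : {scalar gl V},
  l (vec_differential F x) = x (l \o F) by [].
have [I [b [k' [e bE]]]] := gl_frame fV.
(* The witness that [xget] requires: the entrywise derivatives of [F], assembled on the matrix
   units. *)
pose w := \sum_ij x (fun q => k' ij.2 (F q (e ij.1))) *: b ij.
apply: (@xgetPex _ 0 [set w | forall l : {scalar gl V}, l w = x (l \o F)]).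
exists w => l; rewrite linear_sum.
have -> : l \o F = fun q => \sum_ij l (b ij) * k' ij.2 (F q (e ij.1)).
  apply/funext => q; rewrite /= [in LHS](bE (F q)) linear_sum.
  by apply: eq_bigr => ij _; rewrite linearZ mulrC.
rewrite derivation_sum; last by move=> ij; exact/smooth_fun_atZ/sF.
apply: eq_bigr => ij _; rewrite linearZ derivationZ; last exact: sF.
exact: mulrC.
Qed.

End gl_valued.

(** Expanding [B] in a frame reduces the product rule to Leibniz for the scalar products
    [k i (F q) * k j (H q)]. The vectors [w] and [z] are the derivatives of [F] and [H] along [x],
    specified through functionals. *)
Lemma derivation_bilinear n (M : manifoldType R n) (V : lmodType R)
    (B : V -> V -> R) (F H : M -> V) p (x : tangent p) (w z : V) :
  finite_frame V -> (forall v, scalar (B^~ v)) -> (forall u, scalar (B u)) ->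
  (forall k : {scalar V}, smooth_fun_at p (k \o F)) ->
  (forall k : {scalar V}, smooth_fun_at p (k \o H)) ->
  (forall k : {scalar V}, k w = x (k \o F)) ->
  (forall k : {scalar V}, k z = x (k \o H)) ->
  x (fun q => B (F q) (H q)) = B w (H p) + B (F p) z.
Proof.
move=> [I [b [k kE]]] Bl Br sF sH wE zE.
have BE u v : B u v = \sum_i \sum_j B (b i) (b j) * (k i u * k j v).
  rewrite {1}(kE u) -[LHS]/(scalar_of (Bl v) _) linear_sum.
  apply: eq_bigr => i _; rewrite linearZ/= {1}(kE v).
  rewrite -[B _ _]/(scalar_of (Br (b i)) _) linear_sum mulr_sumr.
  by apply: eq_bigr => j _; rewrite linearZ/=; ring.
under eq_fun do rewrite BE.
have sM i j : smooth_fun_at p (fun q => k i (F q) * k j (H q)).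
  exact: smooth_fun_atM (sF _) (sH _).
rewrite derivation_sum; last first.
  by move=> i; apply: smooth_fun_at_sum => j; exact: smooth_fun_atZ.
rewrite !BE -big_split; apply: eq_bigr => i _ /=.
rewrite derivation_sum; last by move=> j; exact: smooth_fun_atZ.
rewrite -big_split; apply: eq_bigr => j _ /=.
rewrite derivationZ// (derivation_leibniz (tangentP x) (sF (k i)) (sH (k j))).
by rewrite wE zE /=; ring.
Qed.

End finite_frames.

(** * Left-invariant fields and the Lie algebra of a Lie group *)

Section left_invariant_fields.
Variables (R : realType) (n : nat) (G : lieGroupType R n).
Implicit Types (g h : G) (f : G -> R) (u v w : tangent (1%g : G)).

Lemma smooth_fun_at_mulg f g h : smooth_fun_at (g * h)%g f ->
  smooth_fun_at ((g, h) : G * G) (fun p : G * G => f (p.1 * p.2)%g).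
Proof. exact: (smooth_fun_at_comp (@mulg_smooth R n G (g, h))). Qed.

Lemma left_translation_smooth g : smooth (left_translation g).
Proof.
move=> h; apply: (@smooth_at_comp _ _ _ _ _ _ _ (fun h => (g, h))
  (fun p : G * G => (p.1 * p.2)%g)); last exact: mulg_smooth.
exact: smooth_pairr.
Qed.

Lemma left_invariant_vfieldE u g f : smooth_fun_at g f ->
  left_invariant_vfield u g f = u (fun h => f (g * h)%g).
Proof.
move=> sf; rewrite /left_invariant_vfield tangent_mapE//.
  exact: left_translation_smooth.
exact: mulg1.
Qed.

Lemma left_invariant_vfield1 u : left_invariant_vfield u 1%g = u.
Proof.
apply: tangent_eqP => f sf; rewrite left_invariant_vfieldE//.
by under eq_fun do rewrite mul1g.
Qed.

Lemma left_invariant_vfield_linear a u v g f :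
  left_invariant_vfield (a *: u + v) g f =
  a * left_invariant_vfield u g f + left_invariant_vfield v g f.
Proof. by rewrite /left_invariant_vfield tangent_map_linear. Qed.

(** Near [g] the function is the partial tangent derivative along [u], in the second factor, of [f]
    composed with multiplication. *)
Lemma smooth_left_invariant_vfield u : smooth_vfield (left_invariant_vfield u).
Proof.
move=> g f sf; have sf1 : smooth_fun_at (g * 1)%g f by rewrite mulg1.
apply: smooth_fun_at_ext (smooth_fun_at_tangent u (smooth_fun_at_mulg sf1)).
apply: filterS (smooth_fun_at_near sf) => h sfh.
by rewrite left_invariant_vfieldE.
Qed.

Lemma lie_bracketE u v f : smooth_fun_at 1%g f ->
  lie_bracket u v f = u (fun g => left_invariant_vfield v g f) -
                      v (fun g => left_invariant_vfield u g f).
Proof.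
move=> sf; rewrite /lie_bracket vbracketE//;
  try exact: smooth_left_invariant_vfield.
by rewrite !left_invariant_vfield1.
Qed.

(** Left translation by [g] preserves the field of [v], so [g] can be moved into the test
    function. *)
Lemma left_invariant_vfield_comp u v g f : smooth_fun_at g f ->
  left_invariant_vfield u g (fun h => left_invariant_vfield v h f) =
  u (fun h => left_invariant_vfield v h (fun k => f (g * k)%g)).
Proof.
move=> sf; rewrite left_invariant_vfieldE; last first.
  exact: smooth_left_invariant_vfield.
have sfg : smooth_fun_at (left_translation g 1%g) f.
  by rewrite /left_translation mulg1.
have sfL := smooth_fun_at_comp (@left_translation_smooth g 1%g) sfg.
apply/esym/(derivation_germ (tangentP u)).
  exact: smooth_left_invariant_vfield.
have cL : {for 1%g, continuous (left_translation g)}.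
  by case: (@left_translation_smooth g 1%g).
(* The two functions are compared only for [h] near the identity, where [f] is smooth at [g * h]; a
   derivation sees no more than this germ. *)
apply: filterS2 (smooth_fun_at_near sfL) (cL _ (smooth_fun_at_near sfg)).
move=> h sh sgh.
rewrite !left_invariant_vfieldE//.
by congr (v _); apply/funext => k; rewrite /= /left_translation mulgA.
Qed.

Lemma left_invariant_vfield_bracket u v g f : smooth_fun_at g f ->
  left_invariant_vfield (lie_bracket u v) g f =
  left_invariant_vfield u g (fun h => left_invariant_vfield v h f) -
  left_invariant_vfield v g (fun h => left_invariant_vfield u h f).
Proof.
move=> sf; rewrite left_invariant_vfieldE// lie_bracketE; last first.
  apply: (smooth_fun_at_comp (@left_translation_smooth g 1%g)).
  by rewrite /left_translation mulg1.
by rewrite !left_invariant_vfield_comp.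
Qed.

Lemma lie_bracket_is_lie_algebra : is_lie_algebra (@lie_bracket R n G).
Proof.
have sX u f g : smooth_fun_at g f ->
    smooth_fun_at g (fun h => left_invariant_vfield u h f).
  exact: smooth_left_invariant_vfield.
have rlin u a v w f : smooth_fun_at 1%g f ->
    u (fun g => left_invariant_vfield (a *: v + w) g f) =
    a * u (fun g => left_invariant_vfield v g f) +
    u (fun g => left_invariant_vfield w g f).
  move=> sf; under eq_fun do rewrite left_invariant_vfield_linear.
  exact: (derivation_linear (tangentP u)) (sX _ _ _ sf) (sX _ _ _ sf).
split.
- move=> v a u u'; apply: tangent_eqP => f sf.
  by rewrite tangentPE !lie_bracketE// rlin// tangentPE; ring.
- move=> u a v v'; apply: tangent_eqP => f sf.
  by rewrite tangentPE !lie_bracketE// rlin// tangentPE; ring.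
- by move=> u; apply: tangent_eqP => f sf; rewrite lie_bracketE// subrr.
(* Each double bracket expands into four triple derivatives of [f], and the twelve terms of the
   cyclic sum cancel in pairs. *)
- pose W u v f := fun g =>
    left_invariant_vfield u g (fun h => left_invariant_vfield v h f).
  have jac u v w f : smooth_fun_at 1%g f -> lie_bracket u (lie_bracket v w) f =
      u (W v w f) - u (W w v f) - (v (W w u f) - w (W v u f)).
    move=> sf; rewrite lie_bracketE//; congr (_ - _); last first.
      rewrite lie_bracketE; last exact: sX.
      by [].
    have sW v' w' : smooth_fun_at 1%g (W v' w' f).
      exact: (sX _ _ _ (sX _ _ _ sf)).
    (* The two terms are merged into one derivative along [u], whose argument has the same germ as
       the field of [lie_bracket v w] applied to [f]. *)
    rewrite -[X in _ - X]mul1r -mulNr addrC -(derivation_linear (tangentP u))//.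
    apply: (derivation_germ (tangentP u)); first exact: sX.
    apply: filterS (smooth_fun_at_near sf) => g sg.
    by rewrite left_invariant_vfield_bracket// mulN1r addrC.
  move=> u v w; apply: tangent_eqP => f sf.
  rewrite -[LHS]/(lie_bracket _ _ f + lie_bracket _ _ f + lie_bracket _ _ f).
  by rewrite !jac// -[RHS]/0; ring.
Qed.

End left_invariant_fields.

(** * Lie group homomorphisms *)

Section morphisms.
Variables (R : realType) (n m : nat).
Variables (P : lieGroupType R n) (Q : lieGroupType R m).
Variable F : P -> Q.
Hypotheses (sF : smooth F) (MF : {morph F : x y / (x * y)%g}).

Lemma morph1 : F 1%g = 1%g.
Proof. by apply: (mulgI (F 1%g)); rewrite -MF !mulg1. Qed.

(** Since [F] intertwines translation by [g] with translation by [F g], the left-invariant fields of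
    a vector and of its image are [F]-related, and so are their commutators. *)
Lemma tangent_map_lie_bracket (u v : tangent (1%g : P)) :
  tangent_map F 1%g (lie_bracket u v) =
  lie_bracket (tangent_map F 1%g u) (tangent_map F (1%g : Q) v).
Proof.
have dE (w : tangent (1%g : P)) f : smooth_fun_at (1%g : Q) f ->
    tangent_map F 1%g w f = w (f \o F).
  by move=> sf; rewrite tangent_mapE//; exact: morph1.
apply: tangent_eqP => f sf.
have sfF1 : smooth_fun_at (F 1%g) f by rewrite morph1.
have sfF : smooth_fun_at 1%g (f \o F) by exact: smooth_fun_at_comp.
rewrite dE// !lie_bracketE// !dE; try exact: smooth_left_invariant_vfield.
suff E (u' v' : tangent (1%g : P)) :
    u' (fun g => left_invariant_vfield v' g (f \o F)) =
    u' ((fun g => left_invariant_vfield (tangent_map F (1%g : Q) v') g f) \o F).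
  by rewrite !E.
apply: (derivation_germ (tangentP u')).
  exact: smooth_left_invariant_vfield.
have cF : {for 1%g, continuous F} by case: (sF 1%g).
have sfFn : \forall g \near (1%g : P), smooth_fun_at (F g) f.
  exact: cF (smooth_fun_at_near sfF1).
apply: filterS sfFn => g sfg.
rewrite /= !left_invariant_vfieldE//; last exact: smooth_fun_at_comp.
rewrite dE; last first.
  apply: (smooth_fun_at_comp (@left_translation_smooth _ _ Q (F g) 1%g)).
  by rewrite /left_translation mulg1.
by congr (v' _); apply/funext => h; rewrite /= MF.
Qed.

End morphisms.

(** * From symplectic Lie groups to quasi-Frobenius Lie algebras *)

Section symplectic.
Variables (R : realType) (m : nat) (Q : lieGroupType R m) (omega : form2 Q).
Arguments omega : clear implicits.

(** Replacing [q] by [F p] here avoids casts along equations such as [g * 1 = g]. *)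
Lemma pullbackE n (M : manifoldType R n) (F : M -> Q) p q (u v : tangent p) :
  F p = q ->
  omega q (tangent_map F q u) (tangent_map F q v) = pullback F omega u v.
Proof. by move=> <-. Qed.

Hypothesis so : is_symplectic_lie_group omega.

Lemma left_invariant_form g u v :
  omega g (left_invariant_vfield u g) (left_invariant_vfield v g) =
  omega 1%g u v.
Proof.
rewrite /left_invariant_vfield pullbackE; last exact: mulg1.
by rewrite (slg_left_invariant so).
Qed.

Lemma slg_quasi_frobenius :
  is_quasi_frobenius (@lie_bracket R m Q) (omega 1%g).
Proof.
have ss := slg_symplectic so; have form := symp_form ss.
split=> [|||u v w].
- exact: lie_bracket_is_lie_algebra.
- exact: form.
- exact: symp_nondegenerate.
- have := symp_closed ss (smooth_left_invariant_vfield u)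
    (smooth_left_invariant_vfield v) (smooth_left_invariant_vfield w) 1%g.
  rewrite /exterior_derivative.
  (* By left invariance the form is constant on such fields, so the three derivative terms of
     [exterior_derivative] vanish. *)
  have cE a b :
      (fun q => omega q (left_invariant_vfield a q) (left_invariant_vfield b q)) =
      fun=> omega 1%g a b.
    by apply/funext => q; exact: left_invariant_form.
  rewrite !cE !derivation_cst !left_invariant_vfield1.
  (* The invariant formula contains the bracket of [u] and [w], the cocycle identity that of [w] and
     [u]; after this change of sign [E] is minus the cocycle identity. *)
  have -> : vbracket (left_invariant_vfield u) (left_invariant_vfield w) 1%g =
      - lie_bracket w u.
    apply: tangent_eqP => f sf; rewrite -[LHS]/(lie_bracket u w f).
    by rewrite -[RHS]/(- lie_bracket w u f) !lie_bracketE// opprB.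
  rewrite -[omega _ (- _) _]/(scalar_of (form_linearl (form 1%g) v) (- _)).
  rewrite linearN /= -/(lie_bracket u v) -/(lie_bracket v w) => E.
  by rewrite -[RHS]oppr0 -E; ring.
Qed.

End symplectic.

(** * The induced actions of the group and of its Lie algebra *)

Section main.
Variables (R : realType) (n m : nat).
Variables (G : lieGroupType R n) (Q : lieGroupType R m).
Variables (omega : form2 Q) (phi : (G * Q)%type -> Q).
Arguments omega : clear implicits.
Hypothesis Hphi : is_G_symplectic_lie_group omega phi.

Let phi_hom g := (gslg_iso Hphi g).1.

Let phi1 g : phi (g, 1%g) = 1%g.
Proof. exact: (morph1 (slghom_mul (phi_hom g))). Qed.

Let smooth_phi g f : smooth_fun_at 1%g f ->
  smooth_fun_at 1%g (fun q => f (phi (g, q))).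
Proof.
move=> sf; apply: (smooth_fun_at_comp (slghom_smooth (phi_hom g) 1%g)).
by rewrite phi1.
Qed.

Let phi'E g u f : smooth_fun_at 1%g f ->
  phi' phi g u f = u (fun q => f (phi (g, q))).
Proof.
by move=> sf; rewrite /= tangent_mapE//; exact: (slghom_smooth (phi_hom g)).
Qed.

Let phi'1 u : phi' phi 1%g u = u.
Proof.
apply: tangent_eqP => f sf; rewrite phi'E//.
by under eq_fun do rewrite (gslg_one Hphi).
Qed.

Let phi'M g h u : phi' phi (g * h)%g u = phi' phi g (phi' phi h u).
Proof.
apply: tangent_eqP => f sf; rewrite !phi'E//; last exact: smooth_phi.
by under eq_fun do rewrite (gslg_mul Hphi).
Qed.

(** With [k] realised as evaluation at some [f], the function is the partial tangent derivative
    along [u] of [f \o phi]. *)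
Let smooth_phi' (k : {scalar tangent (1%g : Q)}) u g :
  smooth_fun_at g (fun h => k (phi' phi h u)).
Proof.
have [f sf kE] := tangent_functional k.
rewrite (_ : (fun h => _) = fun h => u (fun q => f (phi (h, q)))); last first.
  by apply/funext => h; rewrite kE phi'E.
apply: (@smooth_fun_at_tangent _ _ _ _ _ g 1%g u (f \o phi)).
by apply: smooth_fun_at_comp; [exact: (gslg_smooth Hphi)|rewrite phi1].
Qed.

Let phi''E x u (k : {scalar tangent (1%g : Q)}) :
  k (phi'' phi x u) = x (fun g => k (phi' phi g u)).
Proof. exact: (vec_differential_glE (tangent_frame _) smooth_phi'). Qed.

(** Operations on tangent vectors are pointwise, so evaluation at any [f] is a functional to which
    [phi''E] applies. *)
Let phi''Ef x u f : phi'' phi x u f = x (fun g => phi' phi g u f).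
Proof.
have sf : scalar (fun v : tangent (1%g : Q) => v f) by [].
exact: (phi''E x u (scalar_of sf)).
Qed.

Let smooth_phi'_fun u f g : smooth_fun_at g (fun h => phi' phi h u f).
Proof.
have sf : scalar (fun v : tangent (1%g : Q) => v f) by [].
exact: (smooth_phi' (scalar_of sf)).
Qed.

Lemma phi'_representation : is_group_representation (phi' phi).
Proof.
split=> // [g|]; last exact: (smooth_vec_gl (tangent_frame _) smooth_phi').
by exists (phi' phi g^-1%g) => u; rewrite -phi'M ?mulVg ?mulgV phi'1.
Qed.

Lemma phi'_automorphism g :
  is_qf_automorphism (@lie_bracket R m Q) (omega 1%g) (phi' phi g).
Proof.
have [sphi Mphi pphi] := phi_hom g.
split; first exact: gl_linear.
- exact: (rep_bijective phi'_representation).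
- by move=> u v; exact: tangent_map_lie_bracket.
- by move=> u v; rewrite /= pullbackE ?phi1// pphi.
Qed.

(** The product rule is taken at the identity, where [phi'] acts trivially, so the undifferentiated
    factors are [u] and [v]. *)
Let phi'_leibniz (B : tangent (1%g : Q) -> tangent (1%g : Q) -> R)
    (x : tangent (1%g : G)) u v :
  (forall v, scalar (B^~ v)) -> (forall u, scalar (B u)) ->
  x (fun g => B (phi' phi g u) (phi' phi g v)) =
  B (phi'' phi x u) v + B u (phi'' phi x v).
Proof.
move=> Bl Br; rewrite (derivation_bilinear (tangent_frame _) Bl Br
  (smooth_phi' ^~ u ^~ 1%g) (smooth_phi' ^~ v ^~ 1%g)
  (phi''E x u) (phi''E x v)).
by rewrite !phi'1.
Qed.

Lemma phi''_g_quasi_frobenius :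
  is_g_quasi_frobenius (@lie_bracket R n G) (@lie_bracket R m Q) (omega 1%g)
    (phi'' phi).
Proof.
have lieG := lie_bracket_is_lie_algebra G.
have lieQ := lie_bracket_is_lie_algebra Q.
have qf := slg_quasi_frobenius (gslg_symplectic Hphi).
split=> //.
- split=> //.
    move=> a x y; apply: gl_eqP => u; apply: tangent_eqP => f sf.
    by rewrite glPE tangentPE !phi''Ef.
  (* Multiplicativity of [phi'] makes the inner derivative the left-invariant field of [y] applied
     to [h |-> phi' phi h u f], so the commutator takes the form of [lie_bracketE] for this
     function. *)
  have comp x y u f : smooth_fun_at 1%g f ->
      phi'' phi x (phi'' phi y u) f =
      x (fun g => left_invariant_vfield y g (fun h => phi' phi h u f)).
    move=> sf; rewrite phi''Ef; congr (x _); apply/funext => g.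
    rewrite phi'E// phi''Ef left_invariant_vfieldE//.
    congr (y _); apply/funext => h.
    rewrite phi'M [RHS]phi'E// !phi'E//; exact: smooth_phi.
  move=> x y u; apply: tangent_eqP => f sf.
  rewrite phi''Ef lie_bracketE//.
  by rewrite -[RHS]/(phi'' phi _ _ f - phi'' phi _ _ f) !comp.
(* Tested at [f], the bracket is a scalar bilinear form, so [phi'_leibniz] differentiates its
   invariance. *)
- move=> x u v; apply: tangent_eqP => f sf; rewrite phi''Ef.
  under eq_fun do rewrite (qfaut_bracket (phi'_automorphism _)).
  rewrite (phi'_leibniz (B := fun u v => lie_bracket u v f))//.
    by move=> w a u' v'; rewrite (lie_linearl lieQ).
  by move=> w a u' v'; rewrite (lie_linearr lieQ).
- move=> x u v; have [_ form _ _] := qf.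
  rewrite -(phi'_leibniz (B := omega 1%g)); last 2 first.
  + exact: form_linearl.
  + exact: form_linearr.
  (* By invariance the function being differentiated is constant in the group variable. *)
  under eq_fun do rewrite (qfaut_form (phi'_automorphism _)).
  exact: derivation_cst.
Qed.

End main.

Theorem proposition4p3 (R : realType) (n m : nat)
    (G : lieGroupType R n) (Q : lieGroupType R m)
    (omega : form2 Q) (phi : (G * Q)%type -> Q)
    (Hphi : is_G_symplectic_lie_group omega phi) :
  (is_group_representation (phi' phi) /\
   forall g : G,
     is_qf_automorphism (@lie_bracket R m Q) (omega 1%g) (phi' phi g)) /\
  is_g_quasi_frobenius (@lie_bracket R n G) (@lie_bracket R m Q) (omega 1%g)
    (phi'' phi).
Proof.
split; last exact: phi''_g_quasi_frobenius Hphi.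
split; [exact: phi'_representation Hphi|exact: phi'_automorphism Hphi].
Qed.
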